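(* Let $Q=T[H_1,\dots,H_t]$ be a semicomplete composition, i.e. the composition of a semicomplete digraph $T$ with vertex set $\{u_1,\dots,u_t\}$ and digraphs $H_1,\dots,H_t$. If for every $i\in[t]$ the digraph $H_i$ satisfies property BNY, then $Q$ satisfies property BNY.
   Context: Digraphs are finite, without loops and without parallel arcs (a pair of opposite arcs $xy,yx$ is allowed). All paths and cycles are directed, and a single vertex is a path of order 1. Write $[t]=\{1,\dots,t\}$. The order of a digraph is its number of vertices; $V(D)$ and $A(D)$ denote the vertex set and arc set of $D$. Partition: a partition of a digraph $D$ is a pair $(A,B)$ of vertex-disjoint induced subdigraphs of $D$ with $V(A)\cup V(B)=V(D)$. Path parameters: $\lambda(D)$ is the maximum order of a path in $D$. A $k$-path subdigraph of $D$ is a collection of $k$ vertex-disjoint paths in $D$; its order is the total number of vertices on these paths. $\lambda_k(D)$ is the maximum order of a $k$-path subdigraph of $D$; thus $\lambda(D)=\lambda_1(D)$. Property BNY: a digraph $D$ satisfies BNY if for every integer $q$ with $1\le q\le\lambda(D)-1$ there is a partition $(A,B)$ of $D$ such that $\lambda(A)\le q$ and, for all $k\in\{1,2,\dots,|V(B)|\}$, $\lambda_k(B)\le\lambda_k(D)-q$. Composition: let $T$ be a digraph with vertex set $\{u_1,\dots,u_t\}$ and, for $i\in[t]$, let $H_i$ be a (nonempty) digraph with vertex set $\{u_{i,j_i}: j_i\in[n_i]\}$. The composition $Q=T[H_1,\dots,H_t]$ is the digraph with vertex set $\{u_{i,j_i}: i\in[t],\, j_i\in[n_i]\}$ and arc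 set $A(Q)=\bigcup_{i=1}^t A(H_i)\cup\{u_{i,j_i}u_{p,q_p}: u_iu_p\in A(T),\ j_i\in[n_i],\ q_p\in[n_p]\}$. A digraph is semicomplete if for every pair $x,y$ of distinct vertices there is at least one arc between $x$ and $y$. The composition is called semicomplete if $T$ is semicomplete. *)

(* Defs.v *)
From HB Require Import structures.
From mathcomp Require Import all_boot.

Set Implicit Arguments.
Unset Strict Implicit.
Unset Printing Implicit Defensive.

Record digraph := Digraph {
  vertex :> finType;
  darc : rel vertex;
  darc_irrefl : irreflexive darc
}.

Definition dipath (D : digraph) (p : seq D) : bool :=
  [&& p != [::], uniq p & sorted (@darc D) p].

(* A dipath does not repeat vertices, so ranging over sequences of length at
   most #|D|, as the two maxima below do, loses no path. *)
Lemma dipath_size (D : digraph) (p : seq D) : dipath p -> size p <= #|D|.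
Proof. by case/and3P=> _ /card_uniqP <- _; apply: max_card. Qed.

Definition lambda (D : digraph) : nat :=
  \max_(p : {bseq #|D| of D} | dipath p) size p.

Definition kpath (D : digraph) (k : nat) (P : k.-tuple {bseq #|D| of D}) :=
  all (fun p : {bseq #|D| of D} => dipath p) P
  && pairwise (fun p q : {bseq #|D| of D} => [disjoint p & q]) P.

(* If k > #|D| there is no k-path subdigraph and the empty maximum is 0. *)
Definition lambda_k (k : nat) (D : digraph) : nat :=
  \max_(P : k.-tuple {bseq #|D| of D} | kpath P) \sum_(p <- P) size p.

Section Induced.
Variables (D : digraph) (A : {set D}).

Definition induced_arc : rel {x : D | x \in A} :=
  fun x y => darc (val x) (val y).

Lemma induced_arc_irrefl : irreflexive induced_arc.
Proof. by move=> x; apply: darc_irrefl. Qed.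

Definition induced : digraph := Digraph induced_arc_irrefl.
End Induced.

Definition dipartition (D : digraph) (A B : {set D}) : Prop :=
  [disjoint A & B] /\ A :|: B = [set: D].

(* lambda_k B <= lambda_k D - q is written additively because subtraction on
   nat is truncated. *)
Definition BNY (D : digraph) : Prop :=
  forall q : nat, 1 <= q <= lambda D - 1 ->
  exists A B : {set D},
    [/\ dipartition A B,
        lambda (induced A) <= q
      & forall k : nat, 1 <= k <= #|induced B| ->
          lambda_k k (induced B) + q <= lambda_k k D].

Definition semicomplete (D : digraph) : Prop :=
  forall x y : D, x != y -> darc x y || darc y x.

Section Composition.
Variables (T : digraph) (H : T -> digraph).

(* tagged_as x y is the H-component of y, transported to H (tag x); it is only
   used when tag x = tag y. *)
Definition composition_arc : rel {i : T & H i} :=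
  fun x y => (tag x == tag y) && darc (tagged x) (tagged_as x y)
             || darc (tag x) (tag y).

Lemma composition_arc_irrefl : irreflexive composition_arc.
Proof.
by case=> i x; rewrite /composition_arc /= tagged_asE !darc_irrefl andbF.
Qed.

Definition composition : digraph := Digraph composition_arc_irrefl.
End Composition.

(* Main.v *)
Require Import Defs.
From mathcomp Require Import all_boot fingroup perm zify.

(** Why the theorem is true.

    Let [c] send a vertex of the composition [Q] to its class, a vertex of [T].
    A path of [Q] falls into blocks, its maximal stretches inside one class; an
    arc between two blocks depends on their classes only.  Hence whether given
    disjoint blocks can be arranged into [k] paths depends only on the number
    [m i] of blocks in each class [i].  The criterion, [balanced k m], is a cut
    condition: for each set [X] of classes and each [z] in [X] that no member
    of [X] dominates,

      [m z <= k + sum of m over the out-neighbours of X outside X].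

    It is necessary because a walk leaving [z] can come back only through such
    an out-neighbour.  It is sufficient ([path_cover]): together with [k]
    universal vertices the blocks satisfy Hall's condition, semicompleteness
    leaving at most one class of [X] undominated by [X]; so they have a cycle
    factor, and semicompleteness again lets its cycles be merged into one,
    which the [k] universal vertices cut into [k] paths.  The criterion is
    additive in [k] and [m] and stable under pointwise maximum of [m].  Every
    insertion of vertices into a path system below is an instance of these two
    facts.

    For a set [I] of classes with union [W], [splits W q] asks for [A] inside
    [W] whose paths have at most [q] vertices and such that every path system
    avoiding [A] can be enlarged by [q] vertices, all taken from [W], without
    changing the number of paths.  By induction on [I] this holds as soon as
    [W] has a path with more than [q] vertices ([splits_over]).  Suppose that
    no smaller set of classes has such a path.

    If [I] is one class [i], property BNY of [H i] applies, since the blocks in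
    class [i] can be exchanged for as many other ones ([split_class]).

    If [I] is the disjoint union of [I1] and [I2] without arcs from [I2] to
    [I1], then [A] consists of all of [I1] and of a solution for [I2]
    ([split_cut]).

    Otherwise [I] induces a strong digraph.  Suppose first that some path [P]
    with more than [q] vertices has only blocks of order 1 in a class [j].
    Take [P] with the fewest vertices in [j].  Then [A] is made of all the
    other classes and of all vertices of [P] in [j] but one
    ([split_by_singles]).  A longer path inside [A] could be combined with an
    initial piece of [P], by the maximum rule, into a path that contradicts the
    choice of [P].  A path system that meets [j] outside [A] absorbs [P] minus
    one vertex: two block families that share only the class [j] may give up
    one block of [j] when they are joined ([balanced_share]).

    Suppose at last that each class has a block of order at least 2 on every
    such path ([split_strong]).  Let [P] have [q + 1] vertices.  A walk of
    classes from the end of [P] back to its start exists, and breaking a block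
    of [P] in each class on the way closes up the sequence of classes, so that
    the new blocks satisfy [balanced 0].  If they all have order 1, they form a
    path to which the previous case applies.  If not, dropping an end vertex of
    a longer one leaves [q] vertices that can be inserted into any path system,
    and these form [A] ([split_by_cycle]). *)

Set Implicit Arguments.
Unset Strict Implicit.
Unset Printing Implicit Defensive.

(** * Hall's theorem *)

Section Hall.
Variables X Y : finType.

Definition nbhd (N : X -> {set Y}) (S : {set X}) := \bigcup_(x in S) N x.

(** The Halmos-Vaughan induction: either a proper nonempty subset of [A] is
    tight, and then it and the rest of [A] are matched separately, or every
    such subset has a neighbour to spare, and then any edge can be used. The
    matching takes values in [option Y] so that [Y] need not be inhabited. *)
Lemma hall (A : {set X}) (N : X -> {set Y}) :
  (forall S : {set X}, S \subset A -> #|S| <= #|nbhd N S|) ->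
  exists f : {ffun X -> option Y},
    {in A &, injective f} /\ (forall x, x \in A -> exists2 y, y \in N x & f x = Some y).
Proof.
elim/(@ltn_ind): {A}#|A| {-2}A (erefl #|A|) N => n IH A An N hallA.
have [->|[x xA]] := set_0Vmem A.
  by exists [ffun=> None]; split=> x; rewrite inE.
have [/existsP[S /and4P[S0 SA SnA tight]]|loose] :=
  boolP [exists S : {set X}, [&& S != set0, S \subset A, S != A & #|nbhd N S| == #|S|]].
  have propS : S \proper A by rewrite properEneq SnA SA.
  have [||f [f_inj fN]] := IH _ _ S erefl N.
  - by rewrite -An proper_card.
  - by move=> U US; apply/hallA/(subset_trans US).
  pose N' z := N z :\: nbhd N S.
  have [||g [g_inj gN]] := IH _ _ (A :\: S) erefl N'.
  - rewrite -An (cardsD A S) (setIidPr SA).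
    by have := subset_leq_card SA; move: S0; rewrite -card_gt0; lia.
  - move=> U /subsetDP[UA US].
    have /hallA : U :|: S \subset A by rewrite subUset UA.
    rewrite cardsU (disjoint_setI0 US) cards0 subn0.
    have -> : nbhd N (U :|: S) = nbhd N' U :|: nbhd N S.
      apply/setP=> y; rewrite !inE; apply/bigcupP/orP.
        case=> z; rewrite inE => /orP[zU|zS] yN; last by right; apply/bigcupP; exists z.
        case: (boolP (y \in nbhd N S)) => [|yS]; [by right|left].
        by apply/bigcupP; exists z; rewrite // inE yS.
      case=> /bigcupP[z zU]; first by rewrite inE => /andP[_ yz]; exists z; rewrite // inE zU.
      by exists z; rewrite // inE zU orbT.
    rewrite cardsU (eqP tight); lia.
  exists [ffun z => if z \in S then f z else g z]; split=> [z z' zA z'A|z zA]; rewrite !ffunE.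
    case: ifP => zS; case: ifP => z'S; first exact: f_inj.
    - have [y yN ->] := fN z zS; have [|y' + ->] := gN z'; first by rewrite inE z'S.
      rewrite inE => /andP[y'S _] [yy']; case/negP: y'S.
      by apply/bigcupP; exists z; rewrite // -yy'.
    - have [y yN ->] := fN z' z'S; have [|y' + ->] := gN z; first by rewrite inE zS.
      rewrite inE => /andP[y'S _] [yy']; case/negP: y'S.
      by apply/bigcupP; exists z'; rewrite // yy'.
    - by apply: g_inj; rewrite inE ?zS ?z'S.
  case: ifP => zS; first exact: fN.
  have [|y + ->] := gN z; first by rewrite inE zS.
  by rewrite inE => /andP[_ yN]; exists y.
have /hallA : [set x] \subset A by rewrite sub1set.
rewrite cards1 /nbhd big_set1 card_gt0 => /set0Pn[y yN].
pose N' z := N z :\ y.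
have [||g [g_inj gN]] := IH _ _ (A :\ x) erefl N'.
- by rewrite -An [ltnRHS](cardsD1 x) xA.
- move=> U UA; have [->|U0] := eqVneq U set0; first by rewrite cards0.
  have UA' : U \subset A by apply: subset_trans UA (subD1set _ _).
  have UnA : U != A.
    by apply: contraTneq UA => ->; apply/subsetPn; exists x; rewrite // !inE eqxx.
  move: loose; rewrite negb_exists => /forallP/(_ U); rewrite U0 UA' UnA /= => lU.
  have -> : nbhd N' U = nbhd N U :\ y.
    apply/setP=> w; rewrite !inE; apply/bigcupP/andP.
      by case=> z zU; rewrite inE => /andP[wy wN]; split; [move: wy; rewrite inE|apply/bigcupP; exists z].
    by case=> wy /bigcupP[z zU wN]; exists z; rewrite // !inE wy.
  by have := hallA U UA'; rewrite leq_eqVlt eq_sym (negPf lU) (cardsD1 y) /=; lia.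
exists [ffun z => if z == x then Some y else g z]; split=> [z z' zA z'A|z zA]; rewrite !ffunE.
  case: eqP => [->|/eqP zx]; case: eqP => [->//|/eqP z'x].
  - have [|w + ->] := gN z'; first by rewrite !inE z'x.
    by rewrite /N' !inE => /andP[/eqP wy _] [yw]; case: wy.
  - have [|w + ->] := gN z; first by rewrite !inE zx.
    by rewrite /N' !inE => /andP[/eqP wy _] [yw]; case: wy.
  - by apply: g_inj; rewrite !inE ?zx ?z'x.
case: eqP => [->|/eqP zx]; first by exists y.
have [|w + ->] := gN z; first by rewrite !inE zx.
by rewrite inE => /andP[_ wN]; exists w.
Qed.
End Hall.

(** An injection of a finite set into itself is a permutation; read as a
    digraph, it is a cycle factor. *)
Lemma hall_perm (X : finType) (r : rel X) :
  (forall S : {set X}, #|S| <= #|[set y | [exists x in S, r x y]]|) ->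
  exists s : {perm X}, forall x, r x (s x).
Proof.
move=> hallr.
have [|f [f_inj fN]] := @hall X X setT (fun x => [set y | r x y]).
  move=> S _; apply: leq_trans (hallr S) _; apply/subset_leq_card/subsetP=> y.
  by rewrite inE => /existsP[x /andP[xS rxy]]; apply/bigcupP; exists x; rewrite // inE.
have fP x : {y | r x y & f x = Some y}.
  case def_f: (f x) => [y|].
    exists y => //; have [|y' + def_f'] := fN x; first by rewrite inE.
    by rewrite inE; move: def_f'; rewrite def_f => -[->].
  by exfalso; have [|y' _] := fN x; rewrite ?inE // def_f.
pose g x := s2val (fP x).
have g_inj : injective g.
  move=> x x' gx; apply: f_inj; rewrite ?inE //.
  by rewrite (s2valP' (fP x)) (s2valP' (fP x')) -/(g x) gx.
by exists (perm g_inj) => x; rewrite permE; apply: (s2valP (fP x)).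
Qed.

(** * Merging the cycles of a cycle factor *)

Section MergeCycles.
Variables (X : finType) (T : eqType) (t : rel T) (cl : X -> T) (u : T).
Hypothesis t_semi : forall i j, i != j -> t i j || t j i.
Hypothesis u_out : forall i, i != u -> t u i.
Hypothesis u_in : forall i, i != u -> t i u.
Let r : rel X := fun x y => t (cl x) (cl y).

(** Take a cycle factor with the fewest cycles. Exchanging the successors of
    [x] and [y] merges their cycles whenever the two new arcs exist. If a cycle
    avoids [x0], no exchange with the cycle of [x0] is possible; so, going
    along the latter, each of its vertices is found to dominate the former
    entirely, since otherwise either an exchange is possible or two vertices
    share a class. The predecessor of [x0] then allows an exchange, because
    everything dominates [x0]. *)
Lemma merge_cycles (s : {perm X}) (x0 : X) :
  cl x0 = u -> (forall x, r x (s x)) ->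
  exists2 s' : {perm X}, forall x, r x (s' x) & porbit s' x0 = setT.
Proof.
move=> x0u rs.
pose ok (s : {perm X}) := [forall x, r x (s x)].
have ok_s : ok s by apply/forallP.
case: (arg_minnP (fun s : {perm X} => #|porbits s|) ok_s) => {rs ok_s}s /forallP rs min_s.
exists s => //; apply/setP=> x; rewrite inE; apply/idP/negPn/negP => xN.
have no_merge x' y : x' \in porbit s x -> y \in porbit s x0 -> r x' (s y) -> r y (s x') -> False.
  move=> x'x yx0 rx ry.
  have x'y : x' \notin porbit s y.
    apply: contra xN => x'y; move: x'x x'y; rewrite -!eq_porbit_mem in yx0 *.
    by rewrite !(eq_sym _ (porbit s x)) => /eqP -> /eqP ->.
  have := porbits_mul_tperm s x' y; rewrite x'y /=.
  have -> : x' != y by apply: contraNneq x'y => ->; apply: porbit_id.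
  suff /min_s le_s : ok (tperm x' y * s)%g.
    by move=> eq_s; have := leq_add le_s (leqnn 1.*2); rewrite eq_s leq_add2l.
  apply/forallP=> z; rewrite permM; case: tpermP => [->|->|_ _] //.
(* Vertices in one class have the same in- and out-neighbours. *)
have twins x' y : x' \in porbit s x -> y \in porbit s x0 -> cl x' = cl y -> False.
  move=> x'x yx0 cxy; apply: (no_merge x' y x'x yx0).
    by rewrite /r cxy; apply: rs.
  by rewrite /r -cxy; apply: rs.
have s_in z x' : x' \in porbit s z -> s x' \in porbit s z.
  by rewrite -!eq_porbit_mem => /eqP <-; rewrite eq_porbit_mem -{1}(expg1 s) mem_porbit.
have dom n x' : x' \in porbit s x -> r (iter n s x0) x'.
  elim: n x' => [|n IH] x' x'x; rewrite /r.
    by rewrite /= x0u u_out //; apply/eqP => c'; apply: (twins x' x0); rewrite ?porbit_id // c'.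
  have y_in m : iter m s x0 \in porbit s x0 by rewrite -permX mem_porbit.
  have [c'|c'] := eqVneq (cl (iter n.+1 s x0)) (cl x').
    by case: (twins x' (iter n.+1 s x0)).
  have /orP[//|rx'] := t_semi c'.
  by case: (no_merge x' (iter n s x0) x'x (y_in n)) => //; apply/IH/s_in.
pose m := #|porbit s x0|.
have m_gt0 : 0 < m by apply/card_gt0P; exists x0; apply: porbit_id.
apply: (no_merge x (iter m.-1 s x0)); rewrite ?porbit_id -?permX ?mem_porbit //.
  rewrite permX -iterS prednK // iter_porbit /r x0u u_in //.
  by apply/eqP => c'; apply: (twins x x0); rewrite ?porbit_id // c'.
by rewrite permX; apply: dom; apply: s_in; apply: porbit_id.
Qed.
End MergeCycles.

(** * Cutting a cycle at its universal vertices *)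

Section Stars.
Variables (A S : Type) (ra : rel A) (r : rel (A + S)).
Hypothesis r_inl : forall i j, r (inl i) (inl j) = ra i j.
Hypothesis r_inr : forall s s', r (inr s) (inr s') = false.

Definition is_star (x : A + S) := if x is inr _ then true else false.
Definition items := pmap (fun x : A + S => if x is inl i then Some i else None).

(** The two cases are proved together: after an item the current path goes on,
    in [p], and after a star a new path starts. *)
Lemma cut_at_stars x l : path r x l -> ~~ is_star (last x l) ->
  match x with
  | inl i => exists p LL, [/\ path ra i p, p ++ flatten LL = items l,
      size LL = count is_star l & all (fun l => ~~ nilp l && sorted ra l) LL]
  | inr _ => exists LL, [/\ flatten LL = items l,
      size LL = (count is_star l).+1 & all (fun l => ~~ nilp l && sorted ra l) LL]
  end.
Proof.
elim: l x => [|y l IH] x /=; first by case: x => // i _ _; exists [::], [::].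
case/andP=> rxy /IH{}IH /IH; case: x rxy => x rxy; case: y rxy {IH} => [j|s].
- rewrite r_inl => rxj [p [LL [pp def_l szL okL]]].
  by exists (j :: p), LL; split=> //=; rewrite ?rxj // def_l.
- by move=> _ [LL [def_l szL okL]]; exists [::], LL; split=> //=; rewrite add1n.
- move=> _ [p [LL [pp def_l szL okL]]]; exists ((j :: p) :: LL).
  by split=> //=; rewrite ?pp ?def_l ?szL.
- by rewrite r_inr.
Qed.
End Stars.

(** * The cut criterion for block families *)

Section Balanced.
Variable T : digraph.
Hypothesis semiT : semicomplete T.
Implicit Types (m : T -> nat) (X : {set T}).

Definition boundary X := [set y in ~: X | [exists x in X, darc x y]].

Definition balanced k m := forall X z,
  z \in X -> (forall x, x \in X -> ~~ darc x z) -> m z <= \sum_(y in boundary X) m y + k.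

Lemma balancedW k k' m : k <= k' -> balanced k m -> balanced k' m.
Proof. by move=> lek bm X z zX Xz; have := bm X z zX Xz; lia. Qed.

Lemma balanced_eq k m m' : m =1 m' -> balanced k m -> balanced k m'.
Proof.
move=> eqm bm X z zX Xz; have := bm X z zX Xz.
by rewrite eqm (eq_bigr m') // => y _; apply: eqm.
Qed.

Lemma balancedD k1 k2 m1 m2 :
  balanced k1 m1 -> balanced k2 m2 -> balanced (k1 + k2) (fun i => m1 i + m2 i).
Proof.
move=> b1 b2 X z zX Xz; rewrite big_split /=.
by have := b1 X z zX Xz; have := b2 X z zX Xz; lia.
Qed.

(** Only the value at [z] is bounded from above in the criterion, so enlarging
    [m] elsewhere does no harm. *)
Lemma balanced_max k m m1 m2 : balanced k m1 -> balanced k m2 ->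
  (forall i, m1 i <= m i) -> (forall i, m2 i <= m i) ->
  (forall i, (m i <= m1 i) || (m i <= m2 i)) -> balanced k m.
Proof.
move=> b1 b2 le1 le2 lem X z zX Xz.
have le_sum m' : (forall i, m' i <= m i) ->
  \sum_(y in boundary X) m' y <= \sum_(y in boundary X) m y by move=> le'; apply: leq_sum.
case/orP: (lem z) => lez; apply: (leq_trans lez).
  by have := b1 X z zX Xz; have := le_sum _ le1; lia.
by have := b2 X z zX Xz; have := le_sum _ le2; lia.
Qed.

Lemma count_mem_sum X (l : seq T) : count (mem X) l = \sum_(y in X) count_mem y l.
Proof.
elim: l => [|x l IH] /=; first by rewrite big1.
rewrite big_split /= IH; congr (_ + _).
case: (boolP (x \in X)) => xX.
  by rewrite (bigD1 x) //= eqxx big1 ?addn0 // => y /andP[_ /negPf yx]; rewrite eq_sym yx.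
by rewrite big1 // => y yX; case: eqP => // xy; rewrite xy yX in xX.
Qed.

(** After leaving [X] at a vertex of [X], a walk enters the boundary before it
    can reach [z] again, because [z] has no in-neighbour in [X]. The last
    summand accounts for the first visit of a walk that starts outside [X]. *)
Lemma count_path X z : z \in X -> (forall x, x \in X -> ~~ darc x z) ->
  forall l x, path (@darc T) x l ->
  count_mem z l <= count (mem (boundary X)) l + (x \notin X).
Proof.
move=> zX Xz; elim=> [|y l IH] x //= /andP[xy /IH].
case: eqVneq xy => [->|yz] xy.
  have xX : x \notin X by apply: contraL xy; apply: Xz.
  by rewrite zX xX /=; lia.
have [yX|yX] := boolP (y \in X) => /=; first by rewrite inE in_setC yX; lia.
have [xX|xX] := boolP (x \in X) => /=; last by lia.
suff -> : y \in boundary X by lia.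
by rewrite inE in_setC yX; apply/existsP; exists x; rewrite xX.
Qed.

Lemma balanced_sorted (l : seq T) : sorted (@darc T) l -> balanced 1 (fun i => count_mem i l).
Proof.
case: l => [|x l] /= pl X z zX Xz; rewrite ?eqxx //.
have := count_path zX Xz pl; rewrite -(count_mem_sum (boundary X) (x :: l)) /=.
have [->|xz] := eqVneq x z; first by rewrite zX; lia.
by case: (x \in X) => /=; lia.
Qed.

(** Read cyclically from [z], each visit to [z] is followed by a visit to the
    boundary. *)
Lemma balanced_cycle (l : seq T) : path.cycle (@darc T) l -> balanced 0 (fun i => count_mem i l).
Proof.
move=> cl X z zX Xz; rewrite -count_mem_sum addn0.
have [zl|zl] := boolP (z \in l); last by rewrite (count_memPn zl).
case/rot_to: zl cl => i l' def_l; rewrite -(rot_cycle i) def_l /= => /(count_path zX Xz).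
have /seq.permP cnt : perm_eq l (rcons l' z) by rewrite -(perm_rot i) def_l perm_sym perm_rcons.
by rewrite zX -!cnt addn0.
Qed.

Section Hamiltonian.
Variables (B : eqType) (cl : B -> T) (L : seq B) (k : nat).
Hypothesis balL : balanced k (fun i => count (fun b => cl b == i) L).
Hypothesis k_bounds : 0 < k <= size L.

Let item := tnth (in_tuple L).
Let cls (x : 'I_(size L) + 'I_k) : option T :=
  if x is inl i then Some (cl (item i)) else None.
Let arc : rel (option T) := fun i j =>
  match i, j with Some i, Some j => darc i j | None, None => false | _, _ => true end.
Let star0 : 'I_k := Ordinal (proj1 (andP k_bounds)).

Lemma card_items (P : pred T) :
  #|[set i | P (cl (item i))]| = \sum_(y | P y) count (fun b => cl b == y) L.
Proof.
rewrite -sum1dep_card.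
transitivity (\sum_(b <- L | P (cl b)) 1); first by rewrite [RHS]big_tnth.
rewrite (partition_big cl P) //=; apply: eq_bigr => y Py.
by rewrite -sum1_count; apply: eq_bigl => b; case: eqP => [->|]; rewrite ?Py ?andbF.
Qed.

(** A set [S] with a star and an item has every vertex as a neighbour, and a
    set of stars has all [size L >= k] items. For a set of items, at most one
    class [z] of [S] is undominated by [S], by semicompleteness. The items of
    [S] outside [z], the items over the boundary and the [k] stars are then
    distinct neighbours, and the criterion says that they suffice. *)
Lemma hall_items (S : {set 'I_(size L) + 'I_k}) :
  #|S| <= #|[set y | [exists x in S, arc (cls x) (cls y)]]|.
Proof.
set N := [set y | _].
have memN x y : x \in S -> arc (cls x) (cls y) -> y \in N.
  by move=> xS xy; rewrite inE; apply/existsP; exists x; rewrite xS.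
have [->|[x0 x0S]] := set_0Vmem S; first by rewrite cards0.
have [/existsP[s sS]|noStar] := boolP [exists s, inr s \in S].
  have items_N : [set inl i | i : 'I_(size L)] \subset N.
    by apply/subsetP=> _ /imsetP[i _ ->]; apply: (memN (inr s)).
  have [/existsP[i iS]|noItem] := boolP [exists i, inl i \in S].
    apply/subset_leq_card/subsetP=> -[j|s'] _; first by apply: (memN (inr s)).
    by apply: (memN (inl i)).
  apply: leq_trans (subset_leq_card items_N).
  rewrite card_imset ?card_ord => [|i j [] //].
  case/andP: k_bounds => _; apply: leq_trans.
  have : S \subset [set inr s | s : 'I_k].
    apply/subsetP=> -[i|s'] xS; last by apply: imset_f.
    by case/existsP: noItem; exists i.
  by move/subset_leq_card; rewrite card_imset ?card_ord // => i j [].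
have {x0 x0S} [i0 i0S] : exists i, inl i \in S.
  by case: x0 x0S => [i|s] xS; [exists i | case/existsP: noStar; exists s].
have [/subset_leq_card //|] := boolP (S \subset N).
case/subsetPn=> -[i|s] iS; last by case/negP: noStar; apply/existsP; exists s.
move=> iN; pose X := [set cl (item j) | j in [set j | inl j \in S]]; pose z := cl (item i).
have zX : z \in X by apply: imset_f; rewrite inE.
have Xz x : x \in X -> ~~ darc x z.
  case/imsetP=> j; rewrite inE => jS ->; apply: contra iN => jz.
  by apply: (memN (inl j)).
have := balL zX Xz; set mz := count _ L => le_mz.
pose Sz := [set @inl _ 'I_k j | j in [set j | cl (item j) == z]].
pose Nb := [set @inl _ 'I_k j | j in [set j | cl (item j) \in boundary X]].
pose st := [set @inr 'I_(size L) _ s | s : 'I_k].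
have card_Sz : #|Sz| = mz.
  rewrite card_imset => [|? ? [] //].
  by rewrite (card_items (pred1 z)) big_pred1_eq.
have card_Nb : #|Nb| = \sum_(y in boundary X) count (fun b => cl b == y) L.
  by rewrite card_imset => [|? ? [] //]; rewrite card_items.
have card_st : #|st| = k by rewrite card_imset ?card_ord // => ? ? [].
have SzN : S :\: Sz \subset N.
  apply/subsetP=> -[j|s]; rewrite inE => /andP[jz jS]; last first.
    by case/negP: noStar; apply/existsP; exists s.
  apply: (memN (inl i)) => //=.
  have jz' : cl (item j) != z by apply: contra jz => jz; apply: imset_f; rewrite inE.
  have jX : cl (item j) \in X by apply: imset_f; rewrite inE.
  by have := semiT jz'; rewrite (negPf (Xz _ jX)).
have NbN : Nb \subset N.
  apply/subsetP=> _ /imsetP[j + ->]; rewrite inE.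
  rewrite inE => /andP[_ /existsP[_ /andP[/imsetP[j' + ->] j'j]]].
  by rewrite inE => j'S; apply: (memN (inl j')).
have stN : st \subset N by apply/subsetP=> _ /imsetP[s _ ->]; apply: (memN (inl i0)).
have dSN : [disjoint S :\: Sz & Nb].
  rewrite disjoints_subset; apply/subsetP=> x xS; rewrite inE.
  apply/negP=> /imsetP[j + def_x]; rewrite inE inE in_setC => /andP[/negP[]].
  by move: xS; rewrite def_x inE => /andP[_ jS]; apply: imset_f; rewrite inE.
have dst : [disjoint (S :\: Sz) :|: Nb & st].
  rewrite disjoints_subset; apply/subsetP=> x xS; rewrite inE.
  apply/negP=> /imsetP[s _ def_x]; move: xS; rewrite def_x !inE => /orP[/andP[_ sS]|].
    by case/negP: noStar; apply/existsP; exists s.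
  by case/imsetP.
have : ((S :\: Sz) :|: Nb) :|: st \subset N by rewrite !subUset SzN NbN stN.
move/subset_leq_card; rewrite cardsU (disjoint_setI0 dst) cards0 cardsU (disjoint_setI0 dSN).
have := cardsD S Sz; have := subset_leq_card (subsetIr S Sz).
rewrite cards0 card_Sz card_Nb card_st !subn0.
by move=> le_Sz ->; apply: leq_trans; rewrite -addnA -leq_subLR; lia.
Qed.

(** The items and [k] stars, each star adjacent to and from every item, have a
    cycle factor by Hall's theorem; its cycles merge into one, because of the
    stars. As stars are pairwise nonadjacent, deleting them leaves exactly [k]
    nonempty paths. *)
Lemma path_cover : exists LL : seq (seq B),
  [/\ size LL = k, perm_eq (flatten LL) L
    & all (fun l => ~~ nilp l && sorted (relpre cl (@darc T)) l) LL].
Proof.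
have arc_semi i j : i != j -> arc i j || arc j i.
  by case: i j => [i|] [j|] //= ij; apply: semiT.
have arc_out i : i != None -> arc None i by case: i.
have arc_in i : i != None -> arc i None by case: i.
have [s0 arc_s0] := hall_perm hall_items.
have [//|//|s arc_s full] := @merge_cycles _ _ _ cls None arc_semi arc_out arc_in s0 (inr star0).
have := uniq_traject_porbit s (inr star0); have := iter_porbit s (inr star0).
have := porbit_traject s (inr star0); rewrite full.
case: #|_| => [|n] l_all; first by have := l_all (inr star0); rewrite inE.
rewrite /= => iter_s uniq_l.
pose l := traject s (s (inr star0)) n.
have {}l_all x : x \in inr star0 :: l by rewrite -[_ :: _]/(traject s (inr star0) n.+1) -l_all inE.
have path_l : path (relpre cls arc) (inr star0) l.
  by apply: sub_path (fpath_traject s (inr star0) n) => x _ /eqP <-; apply: arc_s.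
have last_l : ~~ is_star (last (inr star0) l).
  have := arc_s (last (inr star0) l); rewrite last_traject iter_s /=.
  by case: (iter n s _).
have [||LL [def_l szLL okLL]] := @cut_at_stars _ _ (relpre (cl \o item) (@darc T))
  (relpre cls arc) _ _ (inr star0) l path_l last_l; [by [] | by [] |].
have perm_l : perm_eq (items l) (enum 'I_(size L)).
  apply: uniq_perm; rewrite ?enum_uniq //.
    by apply: (pmap_uniq (g := inl)) => [[]//|]; case/andP: uniq_l.
  move=> i; rewrite mem_enum mem_pmap; apply/mapP; exists (inl i) => //.
  by have := l_all (inl i); rewrite inE.
exists (map (map item) LL); split.
- rewrite size_map szLL.
  have : size (inr star0 :: l) = size L + k.
    have /card_uniqP <- : uniq (inr star0 :: l) by [].
    transitivity #|{: 'I_(size L) + 'I_k}|; last by rewrite card_sum !card_ord.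
    by apply: eq_card => x; rewrite l_all.
  have szN : count (predC (@is_star _ _)) l = size L.
    rewrite -[RHS]size_enum_ord -(perm_size perm_l) size_pmap.
    by apply: eq_count => -[].
  by rewrite /= -(count_predC (@is_star _ _) l) szN -addSn addnC => /addnI.
- by rewrite -map_flatten def_l -[X in perm_eq _ X](map_tnth_enum (in_tuple L)) perm_map.
- rewrite all_map; apply: sub_all okLL => l' /andP[l'0 sl'].
  by rewrite /= /nilp size_map l'0 sorted_map.
Qed.
End Hamiltonian.
End Balanced.

(** * Path systems *)

Section PathSystems.
Variable D : digraph.
Implicit Types (R : seq (seq D)) (p : seq D) (S : {set D}).

(** A [k]-path subdigraph is such a list with [k] entries, so that its order is
    the size of the flattened list. *)
Definition path_system R :=
  all (fun p => ~~ nilp p && sorted (@darc D) p) R && uniq (flatten R).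

Lemma path_system1 p : path_system [:: p] = dipath p.
Proof. by rewrite /path_system /dipath /= cats0 andbT -andbA [uniq p && _]andbC; case: p. Qed.

Lemma path_system_cat R1 R2 : path_system (R1 ++ R2) =
  [&& path_system R1, path_system R2 & ~~ has (mem (flatten R1)) (flatten R2)].
Proof.
rewrite /path_system all_cat flatten_cat cat_uniq.
by do ![case: (all _ _)] => //=; rewrite ?andbF //; case: (uniq _) => //=; rewrite andbC.
Qed.

Lemma path_system_perm R R' : perm_eq R R' -> path_system R = path_system R'.
Proof. by move=> RR'; rewrite /path_system (perm_all _ RR') (perm_uniq (perm_flatten RR')). Qed.

Lemma size_path_system R S : path_system R -> {subset flatten R <= S} -> size R <= #|S|.
Proof.
case/andP=> okR uR RS.
have /leq_trans -> // : size R <= size (flatten R).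
  elim: R okR {uR RS} => //= p R IH /andP[/andP[p0 _] /IH]; rewrite size_cat.
  by case: p p0 => //= x p _; lia.
rewrite -(card_uniqP uR); apply/subset_leq_card/subsetP => x; exact: RS.
Qed.

Lemma split_path R : path_system R -> has (fun p => 1 < size p) R ->
  exists R', [/\ path_system R', size R' = (size R).+1 & perm_eq (flatten R') (flatten R)].
Proof.
move=> okR /hasP[p pR]; case: p pR => [|x [|y p]] // pR _.
have RR' := perm_to_rem pR; set R0 := rem _ _ in RR'.
exists ([:: x] :: (y :: p) :: R0).
have flat : perm_eq (flatten ([:: x] :: (y :: p) :: R0)) (flatten R).
  by rewrite perm_sym; apply: (perm_flatten RR').
split=> //; last by rewrite (perm_size RR').
move: okR; rewrite (path_system_perm RR') /path_system /=.
by case/andP=> /andP[/andP[_ ->] ->] ->.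
Qed.

(** Split a path with two vertices, or else add an unused vertex as a new path.
    *)
Lemma raise_system k R S : path_system R -> {subset flatten R <= S} ->
  size R <= k -> k <= #|S| ->
  exists R', [/\ path_system R', size R' = k, {subset flatten R' <= S}
    & {subset flatten R <= flatten R'}].
Proof.
move=> okR RS; elim: k => [|k IH] Rk kS.
  by exists R; split=> //; apply/eqP; rewrite -leqn0.
have [|Rk'] := leqP (size R) k; last by exists R; split=> //; lia.
case/IH=> [|R' [okR' szR' R'S RR']]; first by lia.
have [/(split_path okR')[R2 [ok2 sz2 eq2]]|/hasPn sing] := boolP (has (fun p => 1 < size p) R').
  exists R2; split=> //; rewrite ?sz2 ?szR' //.
    by move=> x; rewrite (perm_mem eq2); apply: R'S.
  by move=> x /RR'; rewrite (perm_mem eq2).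
have szf : size (flatten R') <= k.
  rewrite -szR'; elim: R' sing {okR' szR' R'S RR'} => //= p R' IH' sing.
  have := sing p (mem_head _ _); rewrite size_cat.
  by have := IH' (fun q qR => sing q (mem_behead (s := p :: R') qR)); lia.
have /subsetPn[x xS xR'] : ~~ (S \subset flatten R').
  apply/negP=> /subset_leq_card/leq_trans/(_ (card_size _))/leq_trans/(_ szf).
  by rewrite leqNgt kS.
exists ([:: x] :: R'); split=> //=; rewrite ?szR' //.
- by move: okR'; rewrite /path_system /= xR'.
- by move=> y; rewrite inE => /predU1P[->|/R'S].
- by move=> y /RR' yR'; rewrite inE yR' orbT.
Qed.

End PathSystems.

(** * Blocks of a path system *)

Section Blocks.
Variables (Q T : digraph) (c : Q -> T).
Hypothesis semiT : semicomplete T.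
Hypothesis c_cross : forall x y, c x != c y -> darc x y = darc (c x) (c y).
Notation block := (T * seq Q)%type.
Implicit Types (L : seq block) (p : seq Q) (R : seq (seq Q)).

Definition blocks_ok L :=
  all (fun b : block => all (fun x => c x == b.1) b.2) L && path_system (unzip2 L).
Definition verts L := flatten (unzip2 L).
Definition nblocks L (i : T) := count (fun b : block => b.1 == i) L.
Definition class_part L i := [seq b.2 | b : block <- L & b.1 == i].

Lemma blocks_ok_perm L L' : perm_eq L L' -> blocks_ok L = blocks_ok L'.
Proof.
by move=> LL'; rewrite /blocks_ok (perm_all _ LL') (path_system_perm (perm_map _ LL')).
Qed.

Lemma perm_verts L L' : perm_eq L L' -> perm_eq (verts L) (verts L').
Proof. by move=> LL'; apply/perm_flatten/perm_map. Qed.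

Lemma blocks_ok_cat L1 L2 : blocks_ok (L1 ++ L2) =
  [&& blocks_ok L1, blocks_ok L2 & ~~ has (mem (verts L1)) (verts L2)].
Proof.
rewrite /blocks_ok all_cat /unzip2 map_cat path_system_cat /verts.
by case: (all _ L1) => //=; case: (all _ L2) => //=; rewrite ?andbF.
Qed.

Lemma nblocks_cat L1 L2 i : nblocks (L1 ++ L2) i = nblocks L1 i + nblocks L2 i.
Proof. exact: count_cat. Qed.

Lemma nblocks_perm L L' : perm_eq L L' -> nblocks L =1 nblocks L'.
Proof. by move=> /seq.permP LL' i; apply: LL'. Qed.

Lemma nblocks_unzip L i : nblocks L i = count_mem i (unzip1 L).
Proof. by rewrite count_map. Qed.

Lemma size_class_part L i : size (class_part L i) = nblocks L i.
Proof. by rewrite size_map size_filter. Qed.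

Lemma mem_class_part L i x : blocks_ok L -> (x \in flatten (class_part L i)) = (x \in verts L) && (c x == i).
Proof.
case/andP=> /allP mono _; apply/flattenP/andP.
  case=> _ /mapP[b + ->]; rewrite mem_filter => /andP[/eqP bi bL] xb.
  split; last by rewrite -bi; apply: (allP (mono b bL)).
  by apply/flattenP; exists b.2; rewrite // map_f.
case=> /flattenP[_ /mapP[b bL ->] xb] xi; exists b.2 => //; apply: map_f.
by rewrite mem_filter bL andbT -(eqP xi) eq_sym; apply: (allP (mono b bL)).
Qed.

Lemma perm_class_part L i : blocks_ok L ->
  perm_eq (flatten (class_part L i)) [seq x <- verts L | c x == i].
Proof.
move=> okL; apply: uniq_perm => [||x]; last by rewrite mem_class_part // mem_filter andbC.
  have /permPl := perm_filterC (fun b : block => b.1 == i) L => pL.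
  move: okL; rewrite -(blocks_ok_perm pL) blocks_ok_cat.
  by case/and3P=> /and3P[].
by rewrite filter_uniq //; case/and3P: okL.
Qed.

Lemma class_part_system L i : blocks_ok L -> path_system (class_part L i).
Proof.
move=> okL; have /permPl/blocks_ok_perm := perm_filterC (fun b : block => b.1 == i) L.
by rewrite okL blocks_ok_cat => /andP[/andP[_ ->]].
Qed.

Lemma nblocks_gt0 L x : x \in verts L -> blocks_ok L -> 0 < nblocks L (c x).
Proof.
move=> xL okL; rewrite -size_class_part.
by have := mem_class_part (c x) x okL; rewrite xL eqxx; case: (class_part _ _).
Qed.

Lemma nblocks_le L i : blocks_ok L -> nblocks L i <= count (fun x => c x == i) (verts L).
Proof.
move=> okL; rewrite -size_class_part -size_filter.
have uL : uniq (verts L) by case/and3P: okL.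
rewrite -(card_uniqP (filter_uniq _ uL)).
apply: leq_trans (size_path_system (S := [set x in [seq x <- verts L | c x == i]]) _ _) _.
- exact: class_part_system.
- by move=> x; rewrite mem_class_part // inE mem_filter andbC.
- by rewrite cardsE.
Qed.

(** Consecutive vertices in different classes are joined by an arc of [T]; so
    the classes of the maximal blocks form a walk in [T]. *)
Lemma path_blocks p : dipath p -> exists L,
  [/\ blocks_ok L, verts L = p & sorted (@darc T) (unzip1 L)].
Proof.
case/and3P=> p0 up sp.
suff [L [okL def_p sL]] : exists L, [/\
    all (fun b : block => [&& all (fun x => c x == b.1) b.2, ~~ nilp b.2 & sorted (@darc Q) b.2]) L,
    verts L = p & sorted (@darc T) (unzip1 L)].
  exists L; split=> //; apply/andP; split; first by apply: sub_all okL => b /andP[].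
  rewrite /path_system -/(verts L) def_p up andbT all_map.
  by apply: sub_all okL => b /andP[].
elim: p sp {up} p0 => // x [_ _ _|y p IH /= /andP[xy pyp] _].
  by exists [:: (c x, [:: x])]; rewrite /= eqxx.
case: IH => // -[|[i [|y' b]] L] []; rewrite ?andbF //=.
rewrite /verts /= => /andP[/andP[/andP[/eqP ci mb] pb] okL] [yy' def_p] pL.
rewrite {}yy' in ci pb; have [cxy|cxy] := eqVneq (c x) (c y).
  exists ((i, x :: y :: b) :: L); split=> //=; last by rewrite -def_p.
  by rewrite cxy ci eqxx mb xy pb okL.
exists ((c x, [:: x]) :: (i, y :: b) :: L); split=> //=; last 2 first.
- by rewrite -def_p.
- by rewrite pL andbT -ci -c_cross.
by rewrite ci !eqxx mb pb okL.
Qed.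

Lemma system_blocks R : path_system R -> exists L,
  [/\ blocks_ok L, verts L = flatten R, balanced (size R) (nblocks L) & size R <= size L].
Proof.
elim: R => [|p R IH] okR.
  by exists [::]; split=> // X z _ _; rewrite /nblocks.
have := okR; rewrite -cat1s path_system_cat path_system1 => /and3P[dp /IH[L [okL def_R bL szL]] dis].
have [Lp [okp def_p sp]] := path_blocks dp.
exists (Lp ++ L); split.
- rewrite blocks_ok_cat okp okL /= def_p def_R; move: dis; by rewrite /= cats0.
- by rewrite /verts /unzip2 map_cat flatten_cat -!/(unzip2 _) -!/(verts _) def_p def_R.
- apply: (@balanced_eq _ (1 + size R) (fun i => nblocks Lp i + nblocks L i)) => [i|].
    by rewrite nblocks_cat.
  apply: balancedD bL; apply: balanced_eq (balanced_sorted sp) => i.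
  by rewrite nblocks_unzip.
- rewrite !size_cat leq_add //.
  by case: Lp def_p {okp sp} => // def_p; move: dp; rewrite -def_p.
Qed.

Lemma concat_blocks L : blocks_ok L -> sorted (@darc T) (unzip1 L) -> L != [::] -> dipath (verts L).
Proof.
case/andP=> mono /andP[pL uL] sL L0; rewrite /dipath uL /=.
elim: L L0 mono pL sL {uL} => // -[i [|x b]] L IH _ //=.
case: L IH => [_|[j [|y b']] L] /=; last 2 first.
- by move=> _ _; rewrite andbF.
- rewrite /verts /= => IH /andP[mxb mono] /andP[pxb pL] /andP[ij sL].
rewrite cat_path pxb /= (IH isT mono pL sL) andbT.
have /allP/(_ _ (mem_last x b))/eqP ci : all (fun x => c x == i) (x :: b) by [].
case/andP: mono => /andP[/eqP cj _] _.
rewrite c_cross ci cj //; apply: contraTneq ij => ->; by rewrite darc_irrefl.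
- by rewrite /verts /= cats0 => _ /andP[->].
Qed.

Lemma line_up L : blocks_ok L -> balanced 1 (nblocks L) -> L != [::] ->
  exists2 L', perm_eq L' L & sorted (@darc T) (unzip1 L').
Proof.
move=> okL bL L0; have [|LL [szLL LLL /allP okLL]] := path_cover semiT bL.
  by case: L L0 {okL bL}.
case: LL szLL LLL okLL => [|L' [|? ?]] //= _; rewrite cats0 => L'L ok'.
exists L' => //; have /andP[_] := ok' L' (mem_head _ _).
by rewrite sorted_map.
Qed.

(** Arranging the blocks as [path_cover] does yields paths, since any two
    blocks whose classes are adjacent can be concatenated. *)
Lemma assemble k L : blocks_ok L -> balanced k (nblocks L) -> 0 < k <= size L ->
  exists R, [/\ path_system R, size R = k & perm_eq (flatten R) (verts L)].
Proof.
move=> okL bL kL; have [LL [szLL LLL okLL]] := path_cover semiT bL kL.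
have flat : flatten (map verts LL) = verts (flatten LL).
  elim: LL {szLL LLL okLL} => //= L' LL ->.
  by rewrite /verts /unzip2 map_cat flatten_cat.
have perm_fl := perm_verts LLL; rewrite -flat in perm_fl.
exists (map verts LL); rewrite size_map; split=> //.
have uL : uniq (verts L) by case/and3P: okL.
apply/andP; split; last by rewrite (perm_uniq perm_fl).
rewrite -(blocks_ok_perm LLL) in okL.
elim: LL okLL okL {szLL LLL flat perm_fl} => //= L' LL IH /andP[/andP[L'0 sL'] /IH{}IH].
rewrite blocks_ok_cat => /and3P[ok' /IH -> _]; rewrite andbT.
have : dipath (verts L').
  by apply: concat_blocks => //; [rewrite sorted_map | case: L' L'0 {sL' ok'}].
by case/and3P=> + _ ->; case: (verts L').
Qed.

(** Lets a family of blocks be prescribed class by class, to exchange the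
    blocks of some classes for others. *)
Lemma blocks_of_classes (F : T -> seq (seq Q)) :
  (forall i, path_system (F i)) -> (forall i x, x \in flatten (F i) -> c x = i) ->
  exists L, [/\ blocks_ok L, forall i, nblocks L i = size (F i),
    forall x, (x \in verts L) = (x \in flatten (F (c x))),
    size (verts L) = \sum_i size (flatten (F i))
  & {in L, forall b : block, b.2 \in F b.1}].
Proof.
move=> okF cF; pose G (s : seq T) := flatten [seq [seq (i, b) | b <- F i] | i <- s].
have [] : [/\ blocks_ok (G (enum T)), forall i, nblocks (G (enum T)) i = (i \in enum T) * size (F i),
    forall x, (x \in verts (G (enum T))) = (c x \in enum T) && (x \in flatten (F (c x)))
  & size (verts (G (enum T))) = \sum_(i <- enum T) size (flatten (F i))].
  elim: (enum T) (enum_uniq T) => [_|i s IH /= /andP[iNs /IH[okG nG mG sG]]].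
    by split=> //; rewrite ?big_nil.
  have def_v : verts (G (i :: s)) = flatten (F i) ++ verts (G s).
    rewrite /verts /unzip2 map_cat flatten_cat -!map_comp; congr (flatten _ ++ _).
    by rewrite -[RHS]map_id; apply: eq_map.
  split.
  - rewrite /= blocks_ok_cat okG /=; apply/andP; split.
      apply/andP; split.
        rewrite all_map; apply/allP=> b bF /=; apply/allP=> x xb; apply/eqP/cF.
        by apply/flattenP; exists b.
      by rewrite /unzip2 -map_comp map_id_in.
    apply/hasPn=> x; rewrite mG => /andP[xs _].
    rewrite inE /verts /unzip2 -map_comp map_id_in //.
    by apply: contra iNs => /cF <-.
  - move=> j; rewrite /= nblocks_cat nG inE /nblocks count_map /=.
    case: (eqVneq j i) => [->|ij]; last first.
      rewrite (eq_count (a2 := pred0)) ?count_pred0 // => b /=.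
      by rewrite eq_sym (negPf ij).
    rewrite (eq_count (a2 := predT)) => [|b /=]; last by rewrite eqxx.
    by rewrite count_predT (negPf iNs) mul1n addn0.
  - move=> x; rewrite def_v mem_cat mG inE.
    case: (eqVneq (c x) i) => [->|xi] /=; first by rewrite (negPf iNs) orbF.
    by case: (boolP (x \in flatten (F i))) => // /cF xi'; rewrite xi' eqxx in xi.
  - by rewrite def_v size_cat sG big_cons.
move=> ok nG mG sG; exists (G (enum T)); split=> //; last first.
  by move=> b /flatten_mapP[i _ /mapP[p pF ->]].
- by rewrite sG big_enum.
- by move=> x; rewrite mG mem_enum.
- by move=> i; rewrite nG mem_enum mul1n.
Qed.

Lemma size_by_class p : size p = \sum_i count (fun x => c x == i) p.
Proof.
rewrite -sum1_size (partition_big c xpredT) //=.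
by apply: eq_bigr => i _; rewrite sum1_count.
Qed.

End Blocks.

(** * Splitting off q vertices from every path system *)

Section Splitting.
Variable D : digraph.
Implicit Types (A S : {set D}) (R : seq (seq D)) (p : seq D).

Definition paths_at_most A q := forall p, dipath p -> {subset p <= A} -> size p <= q.

(** The new path system may only use [S] besides the old vertices: solutions
    for disjoint parts of a digraph can thus be applied one after the other. *)
Definition gains S A q := forall R, 0 < size R -> path_system R ->
  {subset flatten R <= ~: A} -> exists R', [/\ path_system R', size R' = size R,
    {subset flatten R' <= [predU flatten R & S]} & size (flatten R) + q <= size (flatten R')].

Definition splits S q := exists A : {set D}, [/\ A \subset S, paths_at_most A q & gains S A q].

Lemma long_path A q :
  paths_at_most A q \/ exists p, [/\ dipath p, {subset p <= A} & q < size p].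
Proof.
case: (boolP [exists p : {bseq #|D| of D}, [&& dipath p, all (mem A) p & q < size p]]).
  by case/existsP=> p /and3P[dp /allP pA qp]; right; exists p.
rewrite negb_exists => /forallP noP; left=> p dp /allP pA; rewrite leqNgt.
by have := noP (Bseq (dipath_size dp)); rewrite /= dp pA.
Qed.

Lemma longest_path A : exists p,
  [/\ p = [::] \/ dipath p, {subset p <= A} & paths_at_most A (size p)].
Proof.
have : paths_at_most A #|D| by move=> p /dipath_size.
elim: #|D| => [|n IH] sA; first by exists [::]; split=> //; left.
case: (long_path A n) => [/IH//|[p [dp pA np]]].
exists p; split=> //; first by right.
by have -> : size p = n.+1 by apply/eqP; rewrite eqn_leq np sA.
Qed.

Lemma splitsS S S' q : S \subset S' -> splits S q -> splits S' q.
Proof.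
move=> SS' [A [AS sA gA]]; exists A; split=> //; first exact: subset_trans SS'.
move=> R R0 okR RA; have [R' [okR' szR' R'S gR']] := gA R R0 okR RA.
exists R'; split=> // x /R'S /orP[xR|xS]; apply/orP; [by left|right].
exact: (subsetP SS').
Qed.

Lemma splits0 S : splits S 0.
Proof.
exists set0; split; first exact: sub0set.
  by case=> [//|x p] _ /(_ x (mem_head _ _)); rewrite inE.
by move=> R _ okR _; exists R; rewrite addn0; split=> // x xR; apply/orP; left.
Qed.

End Splitting.

(** * A class met by singletons only *)

Section Bottleneck.
Variables (Q T : digraph) (c : Q -> T).
Hypothesis semiT : semicomplete T.
Hypothesis c_cross : forall x y, c x != c y -> darc x y = darc (c x) (c y).
Notation block := (T * seq Q)%type.
Implicit Types (L : seq block) (p : seq Q) (R : seq (seq Q)) (I : {set T}).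

Definition over I := [set x | c x \in I].

Lemma nblocksP L i : blocks_ok c L -> 0 < nblocks L i -> exists2 x, x \in verts L & c x = i.
Proof.
move=> okL /leq_trans/(_ (nblocks_le i okL)); rewrite -has_count.
by case/hasP=> x xL /eqP; exists x.
Qed.

Lemma nblocks_eq0 L i : blocks_ok c L -> (forall x, x \in verts L -> c x != i) -> nblocks L i = 0.
Proof.
move=> okL Li; apply/eqP; rewrite -leqn0 leqNgt; apply/negP=> /(nblocksP okL)[x /Li].
by move/eqP.
Qed.

(** Families over disjoint sets of classes: [nblocks] of the union is the
    pointwise maximum, so that the number of paths does not grow. *)
Lemma extend_system R L : 0 < size R -> path_system R -> blocks_ok c L ->
  balanced 1 (nblocks L) -> {in flatten R & verts L, forall x y, c x != c y} ->
  exists R', [/\ path_system R', size R' = size R & perm_eq (flatten R') (flatten R ++ verts L)].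
Proof.
move=> R0 okR okL bL dis; have [LR [okLR def_R bLR szLR]] := system_blocks c_cross okR.
have sep i : (nblocks LR i == 0) || (nblocks L i == 0).
  case: posnP => //= /(nblocksP okLR)[x xR <-]; rewrite (nblocks_eq0 okL) // => y yL.
  by rewrite eq_sym dis // -def_R.
have [|||R' [okR' szR' eqR']] := @assemble _ _ c semiT c_cross (size R) (LR ++ L).
- rewrite blocks_ok_cat okLR okL /=; apply/hasPn=> y yL; apply/negP=> /= yR.
  by have := dis y y; rewrite -def_R eqxx => /(_ yR yL).
- apply: (balanced_max bLR (balancedW R0 bL)) => i; rewrite nblocks_cat; try lia.
  by case/orP: (sep i) => /eqP ->; rewrite ?addn0 ?add0n leqnn ?orbT.
- by rewrite R0 size_cat (leq_trans szLR) // leq_addr.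
exists R'; split=> //; apply: (perm_trans eqR').
by rewrite /verts /unzip2 map_cat flatten_cat -!/(unzip2 _) -/(verts LR) def_R.
Qed.

(** Joining two families costs one path more by additivity. If [j] is the only
    common class, giving up one block of [j] makes up for it: for [z = j] the
    left-hand side drops by one; for any other [z], only one of the families
    has blocks in class [z], and as both meet [j], [m] is still at least the
    count of that family everywhere. *)
Lemma balanced_share k (m1 m2 m : T -> nat) j : 0 < k ->
  balanced k m1 -> balanced 1 m2 -> 0 < m1 j -> 0 < m2 j ->
  (forall i, i != j -> (m1 i == 0) || (m2 i == 0)) ->
  (forall i, m i + (i == j) = m1 i + m2 i) -> balanced k m.
Proof.
move=> k0 b1 b2 m1j m2j sep def_m X z zX Xz.
have [zj|zj] := eqVneq z j.
  have := leq_add (b1 X z zX Xz) (b2 X z zX Xz); rewrite -def_m zj eqxx addnACA -big_split /=.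
  rewrite (eq_bigr m); first by lia.
  move=> i; rewrite inE in_setC -def_m => /andP[iX _].
  by have [ij|_] := eqVneq i j; [rewrite ij -zj zX in iX | rewrite addn0].
have le1 : \sum_(i in boundary X) m1 i <= \sum_(i in boundary X) m i.
  apply: leq_sum => i _; have := def_m i; have := sep i.
  by case: eqP => [->|_ /(_ isT)]; lia.
case/orP: (sep z zj) => /eqP mz; have := def_m z; rewrite mz (negPf zj) ?add0n !addn0 => ->.
  have le2 : \sum_(i in boundary X) m2 i <= \sum_(i in boundary X) m i.
    by apply: leq_sum => i _; have := def_m i; case: eqP => [->|_] /=; lia.
  by have := b2 X z zX Xz; lia.
by have := b1 X z zX Xz; lia.
Qed.

Lemma last_block (a : pred block) L : has a L ->
  exists L1 b L2, [/\ L = L1 ++ b :: L2, a b & ~~ has a L2].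
Proof.
elim: L => //= b L IH; have [/IH[L1 [b' [L2 [-> ab aL2]]]] _|nL] := boolP (has a L).
  by exists (b :: L1), b', L2.
by rewrite orbF => ab; exists [::], b, L.
Qed.

Definition singletons_in j L := all (fun b : block => (b.1 == j) ==> (size b.2 == 1)) L.

Lemma single_count j L : blocks_ok c L -> singletons_in j L ->
  nblocks L j = count (fun x => c x == j) (verts L).
Proof.
move=> okL sL; rewrite -size_filter -(perm_size (perm_class_part j okL)) -size_class_part.
rewrite /class_part; elim: L sL {okL} => //= b L IH /andP[sb /IH{}IH].
by case: (b.1 == j) sb => //= /eqP sb; rewrite size_cat sb IH.
Qed.

(** The induction on the number of blocks in [j] replaces the choice of a path
    with the fewest of them. *)
Lemma split_by_singles I q j L : j \in I -> paths_at_most (over (I :\ j)) q ->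
  blocks_ok c L -> sorted (@darc T) (unzip1 L) -> {subset verts L <= over I} ->
  q < size (verts L) -> singletons_in j L -> splits (over I) q.
Proof.
move=> jI sU; move: {2}(nblocks L j).+1 (ltnSn (nblocks L j)) => n.
elim: n L => // n IH L leLn okL sL LI qL singL.
have L0 : L != [::] by apply: contraTneq qL => ->.
have hasj : has (fun b : block => b.1 == j) L.
  rewrite has_count -/(nblocks L j) lt0n; apply: contraL qL => /eqP Lj; rewrite -leqNgt.
  apply: sU (concat_blocks c_cross okL sL L0) _ => x xL.
  rewrite !inE; have := LI x xL; rewrite inE => ->; rewrite andbT.
  by apply: contra_eqN Lj => /eqP <-; rewrite -lt0n (nblocks_gt0 xL okL).
(* The last block in class [j], whose vertex is left out of [A]. *)
have [L1 [b [L2 [def_L bj L2j]]]] := last_block hasj.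
have Lb : perm_eq L (b :: (L1 ++ L2)) by rewrite def_L perm_catC /= perm_cons perm_catC.
have := okL; rewrite (blocks_ok_perm c Lb) -cat1s blocks_ok_cat => /and3P[okb ok12 disb].
have [v0 def_b] : exists v0, b = (j, [:: v0]).
  have := allP singL b; rewrite def_L mem_cat mem_head orbT => /(_ isT).
  by case: (b) (eqP bj) => i [|v [|? ?]] /= ->; rewrite eqxx // => _; exists v.
have sing12 : singletons_in j (L1 ++ L2).
  by move: singL; rewrite /singletons_in (perm_all _ Lb) => /andP[].
have nL : nblocks L j = (nblocks (L1 ++ L2) j).+1.
  by rewrite (nblocks_perm Lb) /nblocks /= bj.
have n2 : nblocks L2 j = 0 by apply/eqP; rewrite -leqn0 leqNgt -has_count.
have n1 : nblocks L1 j = nblocks (L1 ++ L2) j by rewrite nblocks_cat n2 addn0.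
have ok1 : blocks_ok c L1 by move: ok12; rewrite blocks_ok_cat => /and3P[].
have v12 x : x \in verts (L1 ++ L2) -> x \in verts L.
  by move=> x12; rewrite (perm_mem (perm_verts Lb)) /verts /= mem_cat x12 orbT.
have v1 x : x \in verts L1 -> x \in verts L.
  by move=> x1; apply: v12; rewrite /verts /unzip2 map_cat flatten_cat mem_cat x1.
have sing1 : singletons_in j L1 by move: sing12; rewrite /singletons_in all_cat => /andP[].
pose A := over (I :\ j) :|: [set x in verts (L1 ++ L2) | c x == j].
have AI x : x \in A -> c x \in I.
  by rewrite !inE => /orP[/andP[]//|/andP[_ /eqP->]].
(* [L1] is a walk again and has one block in [j] fewer than [L]. *)
have bL1 : balanced 1 (nblocks L1).
  have := sL; rewrite def_L /unzip1 map_cat => /cat_sorted2[s1 _].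
  by apply: balanced_eq (balanced_sorted s1) => i; rewrite nblocks_unzip.
have bL : balanced 1 (nblocks L).
  by apply: balanced_eq (balanced_sorted sL) => i; rewrite nblocks_unzip.
case: (long_path A q) => [sA|[p [dp pA qp]]]; last first.
  have [Lp [okp def_p sp]] := path_blocks c_cross dp.
  have up : uniq p by case/and3P: dp.
  have le_pj : count (fun x => c x == j) p <= nblocks L1 j.
    rewrite n1 single_count // -!size_filter; apply: uniq_leq_size; first exact: filter_uniq.
    move=> x; rewrite !mem_filter => /andP[xj /pA]; rewrite !inE (eqP xj) eqxx /=.
    by rewrite andbT.
  have bLp : balanced 1 (nblocks Lp).
    by apply: balanced_eq (balanced_sorted sp) => i; rewrite nblocks_unzip.
  (* A path in [A] with more than [q] vertices would give a smaller [L]: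
     singletons of [L1] in [j], and elsewhere the larger of the two numbers of
     blocks, covering at least the vertices of the path. *)
  pose m i := if i == j then nblocks L1 j else maxn (nblocks Lp i) (nblocks L1 i).
  have /fin_all_exists[F F_ok] i : exists F, [/\ path_system F, size F = m i,
      {subset flatten F <= [set x | c x == i]} ,
      count (fun x => c x == i) p <= size (flatten F) & i = j -> F = class_part L1 i].
    rewrite /m; case: eqP => [->|/eqP ij].
      exists (class_part L1 j); split=> //.
      + exact: class_part_system ok1.
      + exact: size_class_part.
      + by move=> x; rewrite (mem_class_part _ _ ok1) inE => /andP[].
      + rewrite (perm_size (perm_class_part j ok1)) size_filter -single_count //.
    have sub L0' : blocks_ok c L0' -> {subset flatten (class_part L0' i) <= [set x | c x == i]}.
      by move=> ok0 x; rewrite (mem_class_part _ _ ok0) inE => /andP[].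
    have le_m L0' : blocks_ok c L0' -> nblocks L0' i <= #|[set x | c x == i]|.
      by move=> ok0; rewrite -size_class_part; apply: size_path_system (class_part_system _ ok0) (sub _ ok0).
    have [||F [okF szF Fi subF]] := raise_system (k := maxn (nblocks Lp i) (nblocks L1 i))
      (class_part_system i okp) (sub _ okp).
    + by rewrite size_class_part leq_maxl.
    + by rewrite geq_max !le_m.
    exists F; split=> // [|eij]; last by rewrite eij eqxx in ij.
    rewrite -size_filter; apply: uniq_leq_size; first exact: filter_uniq.
    by move=> x; rewrite mem_filter => /andP[xi xp]; apply: subF; rewrite (mem_class_part _ _ okp) def_p xp.
  have [||L' [okL' nL' mL' szL' inL']] := @blocks_of_classes _ _ c F.
  - by move=> i; case: (F_ok i).
  - by move=> i x; case: (F_ok i) => _ _ /(_ x) + _ _ xF => /(_ xF); rewrite inE => /eqP.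
  have nL'm i : nblocks L' i = m i by rewrite nL'; case: (F_ok i).
  have le_size : size p <= size (verts L').
    by rewrite szL' (size_by_class c); apply: leq_sum => i _; case: (F_ok i).
  have bL' : balanced 1 (nblocks L').
    apply: (balanced_max bLp bL1) => i; rewrite nL'm /m; case: eqP => [->|_] //.
    - by rewrite (leq_trans (nblocks_le j okp)) // def_p.
    - exact: leq_maxl.
    - exact: leq_maxr.
    - by rewrite leqnn orbT.
    - by rewrite !geq_max !leqnn andbT leq_total.
  have L'0 : L' != [::].
    by apply: contraTneq (leq_trans qp le_size) => ->.
  have [L'' L''L' sL''] := line_up semiT okL' bL' L'0.
  apply: (IH L'') => //.
  - by rewrite (nblocks_perm L''L') nL'm /m eqxx n1 -ltnS -nL.
  - by rewrite (blocks_ok_perm c L''L').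
  - move=> x; rewrite (perm_mem (perm_verts L''L')) => /nblocks_gt0/(_ okL').
    rewrite nL'm /m inE; case: eqP => [->//|_]; rewrite leq_max => /orP[].
      by case/(nblocksP okp)=> y; rewrite def_p => /pA/AI + <-.
    by case/(nblocksP ok1)=> y /v1/LI + <-; rewrite inE.
  - by rewrite (perm_size (perm_verts L''L')); apply: leq_trans qp le_size.
  - rewrite /singletons_in (perm_all _ L''L'); apply/allP=> -[i b'] /inL' /= b'F; apply/implyP=> /eqP ij.
    have [_ _ _ _ /(_ ij) def_F] := F_ok i; rewrite def_F in b'F.
    case/mapP: b'F => -[i' b1]; rewrite mem_filter /= => /andP[i'i b1L] ->.
    by have := allP sing1 _ b1L; rewrite /= (eqP i'i) ij eqxx.
exists A; split=> //; first by apply/subsetP=> x /AI; rewrite inE.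
(* If the system meets [j], it does so outside [A], so [L1 ++ L2] is disjoint
   from it and [b] is the block given up. If not, it avoids all classes of [I].
   *)
move=> R R0 okR RA; have [hasR|/hasPn noR] := boolP (has (fun x => c x == j) (flatten R)).
  have [LR [okLR def_R bLR szLR]] := system_blocks c_cross okR.
  have notA x : x \in verts LR -> x \notin A by rewrite def_R => /RA; rewrite inE.
  have [|||R' [okR' szR' eqR']] := @assemble _ _ c semiT c_cross (size R) (LR ++ (L1 ++ L2)).
  - rewrite blocks_ok_cat okLR ok12 /=; apply/hasPn=> y y12 /=; apply: (contraL (@notA y)).
    rewrite !inE y12; have := LI y (v12 y y12); rewrite inE => ->.
    by case: eqP.
  - apply: (balanced_share (j := j) R0 bLR bL).
    + case/hasP: hasR => x xR /eqP <-; apply: nblocks_gt0 okLR; by rewrite def_R.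
    + by rewrite nL.
    + move=> i ij; case: posnP => //= /(nblocksP okLR)[x xR xi]; rewrite (nblocks_eq0 okL) // => y yL.
      apply/eqP=> yi; move: (notA x xR); rewrite !inE xi ij -yi.
      by have := LI y yL; rewrite inE => ->.
    + by move=> i; rewrite nblocks_cat (nblocks_perm Lb) /nblocks /= def_b /= [i == j]eq_sym addnCA addnC.
  - by rewrite R0 size_cat (leq_trans szLR) // leq_addr.
  have vcat : verts (LR ++ (L1 ++ L2)) = flatten R ++ verts (L1 ++ L2).
    by rewrite /verts /unzip2 map_cat flatten_cat -!/(unzip2 _) -/(verts LR) def_R.
  exists R'; split=> // [x|].
    rewrite (perm_mem eqR') vcat mem_cat => /orP[xR|/v12/LI x12]; apply/orP; [by left|by right].
  have szL : size (verts L) = (size (verts (L1 ++ L2))).+1.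
    by rewrite (perm_size (perm_verts Lb)) def_b.
  by rewrite (perm_size eqR') vcat size_cat leq_add2l -ltnS -szL.
have [|R' [okR' szR' eqR']] := extend_system R0 okR okL bL.
  move=> x y xR yL; apply/eqP=> cxy; have := RA x xR; rewrite !inE (noR x xR) cxy.
  by have := LI y yL; rewrite inE => ->.
exists R'; split=> // [x|]; last by rewrite (perm_size eqR') size_cat leq_add2l ltnW.
by rewrite (perm_mem eqR') mem_cat => /orP[xR|/LI x12]; apply/orP; [left|right].
Qed.

End Bottleneck.

(** * The cases of the induction *)

Section Decomposition.
Variables (Q T : digraph) (c : Q -> T).
Hypothesis semiT : semicomplete T.
Hypothesis c_cross : forall x y, c x != c y -> darc x y = darc (c x) (c y).
Notation block := (T * seq Q)%type.
Implicit Types (L : seq block) (p : seq Q) (R : seq (seq Q)) (I : {set T}).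

Lemma perm_unzip1 L L' : nblocks L =1 nblocks L' -> perm_eq (unzip1 L) (unzip1 L').
Proof. by move=> eqn; apply/allP=> i _ /=; rewrite -!nblocks_unzip eqn. Qed.

(** A family that is balanced with [k = 0] can be inserted into any path
    system; having only [q] vertices, it contains no longer path. *)
Lemma split_by_cycle I L q : blocks_ok c L -> {subset verts L <= over c I} ->
  balanced 0 (nblocks L) -> size (verts L) = q -> splits (over c I) q.
Proof.
move=> okL LI bL szL; have uL : uniq (verts L) by case/and3P: okL.
exists [set x in verts L]; split; first by apply/subsetP=> x; rewrite inE => /LI.
  move=> p /and3P[_ up _] pL; rewrite -szL; apply: uniq_leq_size up _ => x /pL.
  by rewrite inE.
move=> R R0 okR RL; have [LR [okLR def_R bLR szLR]] := system_blocks c_cross okR.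
have [|||R' [okR' szR' eqR']] := @assemble _ _ c semiT c_cross (size R) (LR ++ L).
- rewrite blocks_ok_cat okLR okL /=; apply/hasPn=> y yL /=; rewrite def_R.
  by apply: contraL yL => /RL; rewrite !inE.
- rewrite -[size R]addn0; apply: balanced_eq (balancedD bLR bL) => i.
  by rewrite nblocks_cat.
- by rewrite R0 size_cat (leq_trans szLR) // leq_addr.
have vcat : verts (LR ++ L) = flatten R ++ verts L.
  by rewrite /verts /unzip2 map_cat flatten_cat -!/(unzip2 _) -/(verts LR) def_R.
exists R'; split=> // [x|]; last by rewrite (perm_size eqR') vcat size_cat szL.
by rewrite (perm_mem eqR') vcat mem_cat => /orP[xR|/LI xL]; apply/orP; [left|right].
Qed.

(** The last hypothesis on [I] is the strong connectivity of the digraph on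
    [I], with a closed walk in the case [a = b]. *)
Lemma split_strong I q p :
  dipath p -> {subset p <= over c I} -> q < size p ->
  (forall j, j \in I -> paths_at_most (over c (I :\ j)) q) ->
  (forall a b, a \in I -> b \in I -> exists ws : seq T,
     [/\ uniq ws, {subset ws <= I} & path (@darc T) b (rcons ws a)]) ->
  splits (over c I) q.
Proof.
move=> dp pI qp sI walkI.
(* Exactly [q + 1] vertices: removing a single one must leave [q]. *)
have {p dp pI qp} [p [dp pI szp]] : exists p, [/\ dipath p, {subset p <= over c I} & size p = q.+1].
  exists (take q.+1 p); split; last by rewrite size_takel.
    case/and3P: dp => p0 up sp; rewrite /dipath take_uniq // take_sorted // andbT.
    by case: (p) p0.
  by move=> x /mem_take /pI.
have [L [okL def_p sL]] := path_blocks c_cross dp.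
have [/existsP[j /andP[jI sj]]|noSingle] := boolP [exists j in I, singletons_in j L].
  apply: (split_by_singles semiT c_cross jI (sI j jI) okL sL) => //; rewrite def_p //.
  by rewrite szp.
have multi j : j \in I -> has (fun r => 1 < size r) (class_part L j).
  move=> jI; move: noSingle; rewrite negb_exists => /forallP/(_ j); rewrite jI /=.
  case/allPn=> b bL; rewrite negb_imply => /andP[bj sb].
  apply/hasP; exists b.2; first by apply: map_f; rewrite mem_filter bj.
  have /andP[_ /andP[/allP/(_ b.2)]] := okL.
  by rewrite map_f // => /(_ isT); move: sb; case: (b.2) => [|x [|y r]].
have LI i : i \in unzip1 L -> i \in I.
  rewrite -has_pred1 has_count -nblocks_unzip => /(nblocksP okL)[x + <-].
  by rewrite def_p => /pI; rewrite inE.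
case def_u: (unzip1 L) => [|a l].
  by move: dp; rewrite -def_p /verts; case: (L) def_u.
have [||ws [uws wsI pws]] := walkI a (last a l); first by rewrite LI // def_u mem_head.
  by rewrite LI // def_u mem_last.
(* Break one block in each class of [ws]. *)
have /fin_all_exists[F F_ok] i : exists F, [/\ path_system F,
    size F = nblocks L i + (i \in ws) & perm_eq (flatten F) (flatten (class_part L i))].
  have [iws|_] := boolP (i \in ws); last first.
    by exists (class_part L i); rewrite addn0 size_class_part; split=> //; apply: class_part_system okL.
  have [F [okF szF eqF]] := split_path (class_part_system i okL) (multi i (wsI i iws)).
  by exists F; rewrite szF size_class_part addn1.
have memF i x : (x \in flatten (F i)) = (x \in p) && (c x == i).
  by case: (F_ok i) => _ _ /perm_mem ->; rewrite (mem_class_part _ _ okL) def_p.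
have [||L' [okL' nL' mL' szL' _]] := @blocks_of_classes _ _ c F.
- by move=> i; case: (F_ok i).
- by move=> i x; rewrite memF => /andP[_ /eqP].
have bL' : balanced 0 (nblocks L').
  apply: (@balanced_eq _ _ (fun i => count_mem i (unzip1 L ++ ws))) => [i|].
    rewrite nL' count_cat -nblocks_unzip; case: (F_ok i) => _ -> _.
    by rewrite count_uniq_mem.
  apply: balanced_cycle; rewrite def_u /= rcons_cat cat_path pws andbT.
  by move: sL; rewrite def_u.
have memL' x : (x \in verts L') = (x \in p) by rewrite mL' memF eqxx andbT.
have uL' : uniq (verts L') by case/and3P: okL'.
have szL'p : size (verts L') = q.+1.
  by rewrite -szp; apply/perm_size/uniq_perm => //; case/and3P: dp.
(* A block of order at least 2 left after the breaking loses its first vertex.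
   *)
have [/hasP[b b_in szb]|/hasPn noBig] := boolP (has (fun b : block => 1 < size b.2) L'); last first.
  have L'0 : L' != [::] by apply/eqP=> L'0; rewrite L'0 in szL'p.
  have [L2 L2L' sL2] := line_up semiT okL' (balancedW (leq0n 1) bL') L'0.
  have aI : a \in I by rewrite LI // def_u mem_head.
  apply: (split_by_singles semiT c_cross aI (sI a aI) _ sL2).
  - by rewrite (blocks_ok_perm c L2L').
  - by move=> x; rewrite (perm_mem (perm_verts L2L')) memL' => /pI.
  - by rewrite (perm_size (perm_verts L2L')) szL'p.
  - rewrite /singletons_in (perm_all _ L2L'); apply/allP=> b b_in; apply/implyP=> _.
    have := noBig b b_in; have /andP[_ /andP[/allP/(_ b.2)]] := okL'.
    by rewrite map_f // => /(_ isT); case: (b.2) => [|x [|y r]].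
have := perm_to_rem b_in; set L0 := rem _ _; case: b szb {b_in} L0 => i [|x [|y r]] //= _ L0 L'b.
have okb : blocks_ok c ((i, x :: y :: r) :: L0) by rewrite -(blocks_ok_perm c L'b).
have nb : nblocks ((i, y :: r) :: L0) =1 nblocks L' by move=> j; rewrite (nblocks_perm L'b).
apply: (@split_by_cycle I ((i, y :: r) :: L0)).
- move: okb; rewrite /blocks_ok /path_system /=.
  by case/andP=> /andP[/andP[_ ->] ->] /andP[/andP[/andP[_ ->] ->] /andP[_ ->]].
- move=> z zL; have : z \in p by rewrite -memL' (perm_mem (perm_verts L'b)) /verts inE zL orbT.
  by move/pI.
- by apply: balanced_eq bL' => j; rewrite nb.
- by have := perm_size (perm_verts L'b); rewrite szL'p => -[->].
Qed.

(** Without arcs from [I2] to [I1], a path that has entered [I2] stays there.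
    *)
Lemma cut_path I1 I2 p : {subset p <= over c (I1 :|: I2)} ->
  (forall i j, i \in I2 -> j \in I1 -> ~~ darc i j) -> [disjoint I1 & I2] ->
  sorted (@darc Q) p ->
  exists p1 p2, [/\ p = p1 ++ p2, {subset p1 <= over c I1} & {subset p2 <= over c I2}].
Proof.
move=> + back dis; elim: p => [|x p IH] pI sp; first by exists [::], [::].
have dis_neq i j : i \in I2 -> j \in I1 -> i != j.
  by move=> i2 j1; apply: contraTneq i2 => ->; rewrite (disjointFr dis j1).
have [x2|x2] := boolP (c x \in I2).
  exists [::], (x :: p); split=> // y; rewrite inE => /predU1P[->|]; first by rewrite inE.
  elim: p x x2 {IH} pI sp => // z p IH x x2 pI /= /andP[xz pz].
  have z2 : c z \in I2.
    have := pI z; rewrite !inE eqxx orbT => /(_ isT)/orP[z1|//].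
    by have := back _ _ x2 z1; rewrite -c_cross ?xz // dis_neq.
  rewrite inE => /predU1P[->|]; first by rewrite inE.
  by apply: (IH z z2) => // w wp; apply: pI; rewrite inE wp orbT.
have [||p1 [p2 [-> p1I p2I]]] := IH.
- by move=> y yp; apply: pI; rewrite inE yp orbT.
- by apply: path_sorted sp.
exists (x :: p1), p2; split=> // y; rewrite inE => /predU1P[->|/p1I//].
by have := pI x (mem_head _ _); rewrite !inE (negPf x2) orbF.
Qed.

Lemma dipath_pieces p p1 p2 : dipath p -> p = p1 ++ p2 ->
  (p1 = [::] \/ dipath p1) /\ (p2 = [::] \/ dipath p2).
Proof.
case/and3P=> _ + + def_p; rewrite {}def_p cat_uniq => /and3P[u1 _ u2] /cat_sorted2[s1 s2].
rewrite /dipath; split.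
  by case: p1 u1 s1 => [|x r] -> ->; [left | right].
by case: p2 u2 s2 => [|x r] -> ->; [left | right].
Qed.

Lemma split_cut I1 I2 q p : I2 != set0 -> [disjoint I1 & I2] ->
  (forall i j, i \in I2 -> j \in I1 -> ~~ darc i j) ->
  dipath p -> {subset p <= over c (I1 :|: I2)} -> q < size p ->
  paths_at_most (over c I1) q ->
  (forall q' p', dipath p' -> {subset p' <= over c I2} -> q' < size p' ->
     splits (over c I2) q') ->
  splits (over c (I1 :|: I2)) q.
Proof.
move=> I20 dis back dp pI qp s1 IH.
have [l [l0 lI1 lmax]] := longest_path (over c I1).
have leq_l : size l <= q by case: l0 => [->//|dl]; apply: s1.
have cut p' : dipath p' -> {subset p' <= over c (I1 :|: I2)} -> exists p1 p2,
    [/\ p' = p1 ++ p2, {subset p2 <= over c I2}, size p1 <= size l & p2 = [::] \/ dipath p2].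
  move=> dp' p'I; have /and3P[_ _ sp'] := dp'.
  have [p1 [p2 [def_p' p1I p2I]]] := cut_path p'I back dis sp'.
  have [p10 p20] := dipath_pieces dp' def_p'.
  by exists p1, p2; split=> //; case: p10 => [->//|dp1]; apply: lmax.
have [p1 [p2 [def_p p2I szp1 p20]]] := cut p dp pI.
have szp : size p = size p1 + size p2 by rewrite def_p size_cat.
have szp2 : q - size l < size p2 by clear -szp szp1 qp leq_l; lia.
have [|A2 [A2I sA2 gA2]] := IH (q - size l) p2 _ p2I szp2.
  by case: p20 => // p20; rewrite p20 in szp2.
exists (over c I1 :|: A2); split.
- apply/subsetP=> x; rewrite !inE => /orP[->//|/(subsetP A2I)].
  by rewrite inE => ->; rewrite orbT.
- move=> p' dp' p'A; have [|p1' [p2' [def_p' p2'I szp1' p20']]] := cut p' dp'.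
    by move=> x /p'A; rewrite !inE => /orP[->//|/(subsetP A2I)]; rewrite inE orbC => ->.
  rewrite def_p' size_cat.
  have : size p2' <= q - size l.
    case: p20' => [->//|dp2]; apply: sA2 => // x xp2.
    have := p'A x; rewrite def_p' mem_cat xp2 orbT inE => /(_ isT)/orP[|//].
    by have := p2'I x xp2; rewrite !inE => x2 x1; rewrite (disjointFr dis x1) in x2.
  by move=> szp2'; rewrite -(subnKC leq_l) leq_add.
move=> R R0 okR RA; have [|R1 [ok1 sz1 R1I gR1]] := gA2 R R0 okR.
  by move=> x /RA; rewrite !inE negb_or => /andP[].
case: l0 => [l0|dl].
  exists R1; split=> // [x /R1I|]; last by rewrite l0 subn0 in gR1.
  by rewrite !inE => /orP[->//|->]; rewrite !orbT.
have [Ll [okl def_l sl]] := path_blocks c_cross dl.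
have [|||||R2 [ok2 sz2 eq2]] := @extend_system _ _ c semiT c_cross R1 Ll.
- by rewrite sz1.
- by [].
- by [].
- by apply: balanced_eq (balanced_sorted sl) => i; rewrite nblocks_unzip.
- move=> x y xR1; rewrite def_l => /lI1; rewrite inE => y1; apply: contraTneq y1 => <-.
  case/orP: (R1I x xR1) => [/RA|]; rewrite !inE ?negb_or; first by case/andP.
  by move=> x2; rewrite (disjointFl dis x2).
exists R2; split=> //; first by rewrite sz2.
- move=> x; rewrite (perm_mem eq2) mem_cat def_l => /orP[/R1I|/lI1]; rewrite !inE.
    by case/orP=> ->; rewrite ?orbT.
  by move=> ->; rewrite orbT.
- by rewrite (perm_size eq2) size_cat def_l -(subnK leq_l) addnA leq_add2r.
Qed.

(** Weaker than [splits]: property BNY of a single class speaks only of path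
    systems inside it. *)
Definition class_splits i q := exists A : {set Q}, [/\ A \subset over c [set i], paths_at_most A q
  & forall R, 0 < size R -> path_system R -> {subset flatten R <= over c [set i] :\: A} ->
    exists R', [/\ path_system R', size R' = size R, {subset flatten R' <= over c [set i]}
      & size (flatten R) + q <= size (flatten R')]].

(** The blocks of [R] in class [i] form a path system of that class, and an
    exchange that keeps their number keeps the criterion. If there are none, a
    long path of the class can be inserted as one block. *)
Lemma split_class i q p : dipath p -> {subset p <= over c [set i]} -> q < size p ->
  class_splits i q -> splits (over c [set i]) q.
Proof.
move=> dp pi qp [A [Ai sA gA]]; exists A; split=> // R R0 okR RA.
have [LR [okLR def_R bLR szLR]] := system_blocks c_cross okR.
have [hasR|noR] := posnP (nblocks LR i).
  have [|||R' [okR' szR' eqR']] := @extend_system _ _ c semiT c_cross R [:: (i, p)] R0 okR.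
  - rewrite /blocks_ok /= path_system1 dp !andbT; apply/allP=> x /pi.
    by rewrite !inE.
  - by apply: (balanced_eq _ (@balanced_sorted T [:: i] isT)) => j; rewrite nblocks_unzip.
  - move=> x y; rewrite -def_R /verts /= cats0 => xR /pi; rewrite !inE => /eqP ->.
    by apply: contra_eqN hasR => /eqP <-; rewrite -lt0n nblocks_gt0.
  rewrite /verts /= cats0 in eqR'; exists R'; split=> // [x|]; last first.
    by rewrite (perm_size eqR') size_cat leq_add2l ltnW.
  by rewrite (perm_mem eqR') mem_cat => /orP[xR|/pi xp]; apply/orP; [left|right].
have [|||Ri [okRi szRi Ri_i gRi]] := gA (class_part LR i).
- by rewrite size_class_part.
- exact: class_part_system okLR.
- move=> x; rewrite (mem_class_part _ _ okLR) def_R !inE => /andP[/RA xA xi].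
  by rewrite xi andbT; move: xA; rewrite inE.
pose F j := if j == i then Ri else class_part LR j.
have Fi : F i = Ri by rewrite /F eqxx.
have [||L' [okL' nL' mL' szL' _]] := @blocks_of_classes _ _ c F.
- by move=> j; rewrite /F; case: eqP => // _; apply: class_part_system okLR.
- move=> j x; rewrite /F; case: eqP => [->/Ri_i|_]; first by rewrite !inE => /eqP.
  by rewrite (mem_class_part _ _ okLR) => /andP[_ /eqP].
have nn : nblocks L' =1 nblocks LR.
  by move=> j; rewrite nL' /F; case: eqP => [->|_]; rewrite ?szRi size_class_part.
have [||R' [okR' szR' eqR']] := @assemble _ _ c semiT c_cross (size R) L' okL'.
- by apply: balanced_eq bLR => j; rewrite nn.
- by rewrite R0; have := perm_size (perm_unzip1 nn); rewrite !size_map => ->.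
exists R'; split=> // [x|].
  rewrite (perm_mem eqR') mL' /F; case: eqP => [_ /Ri_i xi|_]; first by apply/orP; right.
  by rewrite (mem_class_part _ _ okLR) def_R => /andP[xR _]; apply/orP; left.
rewrite (perm_size eqR') szL' -def_R (size_by_class c) (bigD1 i) //= [leqRHS](bigD1 i) //= Fi.
have -> : \sum_(j | j != i) size (flatten (F j)) =
    \sum_(j | j != i) count (fun x => c x == j) (verts LR).
  apply: eq_bigr => j ji; rewrite /F (negPf ji) (perm_size (perm_class_part j okLR)).
  exact: size_filter.
by move: gRi; rewrite (perm_size (perm_class_part i okLR)) size_filter addnAC leq_add2r.
Qed.

(** If the classes reachable from [b] inside [I] do not include [a], they form
    a closed set, and [split_cut] applies to it; if there are none at all, it
    applies to [b] alone. *)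
Theorem splits_over I q p :
  (forall i q p, 0 < q -> dipath p -> {subset p <= over c [set i]} -> q < size p ->
     class_splits i q) ->
  dipath p -> {subset p <= over c I} -> q < size p -> splits (over c I) q.
Proof.
move=> classH; have [n] := ubnP #|I|; elim: n I q p => // n IH I q p leIn dp pI qp.
have [->|q0] := posnP q; first exact: splits0.
have [x xp] : exists x, x \in p by case: (p) dp => // x r _; exists x; rewrite mem_head.
have xI : c x \in I by have := pI x xp; rewrite inE.
have IHs (J : {set T}) q' p' : J \proper I -> dipath p' -> {subset p' <= over c J} -> q' < size p' ->
    splits (over c J) q'.
  by move=> JI; apply: IH; apply: leq_trans (proper_card JI) _; rewrite -ltnS.
have sub_over (J : {set T}) : J \subset I -> over c J \subset over c I.
  by move=> JI; apply/subsetP=> y; rewrite !inE; apply: (subsetP JI).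
have [done|sI] : splits (over c I) q \/ forall J : {set T}, J \proper I -> paths_at_most (over c J) q.
  case: (boolP [exists J : {set T}, (J \proper I) &&
      [exists p : {bseq #|Q| of Q}, [&& dipath p, all (mem (over c J)) p & q < size p]]]).
    case/existsP=> J /andP[JI /existsP[p' /and3P[dp' /allP p'J qp']]]; left.
    by apply: splitsS (sub_over J (proper_sub JI)) (IHs J q p' JI dp' p'J qp').
  rewrite negb_exists => /forallP noJ; right=> J JI.
  case: (long_path (over c J) q) => // -[p' [dp' p'J qp']].
  have := noJ J; rewrite JI negb_exists => /forallP/(_ (Bseq (dipath_size dp'))).
  by rewrite /= dp' qp' andbT => /allPn[y /p'J yJ]; rewrite /= yJ.
  exact: done.
pose r : rel T := fun i j => [&& darc i j, i \in I & j \in I].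
have [I1|I1] := eqVneq I [set c x].
  by rewrite I1 in pI *; apply: (split_class dp pI qp (classH _ _ _ q0 dp pI qp)).
have cut (J : {set T}) : J != set0 -> J \proper I -> (forall i j, i \in J -> j \in I :\: J -> ~~ darc i j) ->
    splits (over c I) q.
  move=> J0 JI back; have def_I : I = (I :\: J) :|: J.
    by rewrite -{1}(setID I J) (setIidPr (proper_sub JI)) setUC.
  rewrite def_I; apply: (split_cut J0 _ back dp _ qp).
  - by rewrite disjoints_subset; apply/subsetP=> i; rewrite !inE => /andP[].
  - by rewrite -def_I.
  - apply: sI; rewrite properE subsetDl /=; case/set0Pn: J0 => i iJ.
    apply/subsetPn; exists i; first exact: (subsetP (proper_sub JI)).
    by rewrite inE iJ.
  - by move=> q' p'; apply: IHs.
have [/forallP walk|] := boolP [forall a, forall b, (a \in I) ==> (b \in I) ==>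
    [exists w, r b w && connect r w a]].
  apply: (split_strong dp pI qp) => [j jI|a b aI bI].
    by apply: sI; apply: properD1.
  have /forallP/(_ b) := walk a; rewrite aI bI /= => /existsP[w /andP[bw /connectP[s ps ->]]].
  case/shortenP: ps => s' ps' us' _.
  have path_r : path r b (w :: s') by rewrite /= bw.
  exists (belast w s'); rewrite -lastI; split.
  - by move: us'; rewrite lastI rcons_uniq => /andP[].
  - move=> i /mem_belast; have : all (mem I) (w :: s').
      elim: (w :: s') (b) path_r => //= y l IHl b' /andP[/and3P[_ _ ->] /IHl].
      by [].
    by move/allP; apply.
  - by apply: sub_path path_r => i j /and3P[].
rewrite negb_forall => /existsP[a]; rewrite negb_forall => /existsP[b].
rewrite negb_imply => /andP[aI]; rewrite negb_imply => /andP[bI noWalk].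
pose J := [set i in I | [exists w, r b w && connect r w i]].
have aJ : a \notin J.
  by rewrite inE aI; apply: noWalk.
have JI : J \proper I.
  rewrite properE; apply/andP; split; first by apply/subsetP=> i; rewrite inE => /andP[].
  by apply/subsetPn; exists a.
have [J0|J0] := eqVneq J set0; last first.
  apply: (cut J) => // i j; rewrite !inE => /andP[iI /existsP[w /andP[bw wi]]].
  case/andP=> + jI; rewrite jI /=; apply: contra => ij.
  apply/existsP; exists w; rewrite bw /=; apply: connect_trans wi (connect1 _).
  by rewrite /r ij iI jI.
apply: (cut [set b]).
- by apply/set0Pn; exists b; rewrite inE.
- rewrite properEneq sub1set bI andbT; apply: contraNneq I1 => bI'.
  by move: xI; rewrite -bI' inE => /eqP ->.
- move=> i j; rewrite !inE => /eqP -> /andP[_ jI].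
  apply/negP=> bj; have : j \in J; last by rewrite J0 inE.
  by rewrite inE jI; apply/existsP; exists j; rewrite /r bj bI jI connect0.
Qed.
End Decomposition.

(** * Property BNY in terms of path systems *)

Section Embedding.
Variables (D1 D2 : digraph) (f : D1 -> D2).
Hypothesis f_inj : injective f.
Hypothesis f_arc : forall x y, darc (f x) (f y) = darc x y.

Lemma path_system_map R : path_system (map (map f) R) = path_system R.
Proof.
rewrite /path_system -map_flatten (map_inj_uniq f_inj) all_map; congr (_ && _).
apply: eq_all => p /=; rewrite /nilp size_map sorted_map; congr (_ && _).
by apply: eq_sorted => x y /=; apply: f_arc.
Qed.

Lemma dipath_map p : dipath (map f p) = dipath p.
Proof. by rewrite -!path_system1 -path_system_map. Qed.

(** Together with [path_system_map], this moves path systems between a digraph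
    and an induced subdigraph, or between [H i] and its copy in the
    composition. *)
Lemma lift_system R : {subset flatten R <= codom f} -> exists R0, R = map (map f) R0.
Proof.
elim: R => [|p R IH] fR; first by exists [::].
have [|R0 ->] := IH; first by move=> x xR; apply: fR; rewrite mem_cat xR orbT.
have : {subset p <= codom f} by move=> x xp; apply: fR; rewrite mem_cat xp.
elim: p {fR} => [|x p IHp] fp; first by exists ([::] :: R0).
have [|[|p0 R1] // [-> ->]] := IHp; first by move=> y yp; apply: fp; rewrite inE yp orbT.
by have /codomP[x0 ->] := fp x (mem_head _ _); exists ((x0 :: p0) :: R1).
Qed.

Lemma lift_path p : {subset p <= codom f} -> exists p0, p = map f p0.
Proof.
move=> fp; have [|[|p0 [|? ?]] // [->]] := @lift_system [:: p]; last by exists p0.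
by move=> x; rewrite /= cats0; apply: fp.
Qed.
End Embedding.

Section PathParameters.
Variable D : digraph.

Lemma path_system_pairwise (R : seq (seq D)) : path_system R =
  all (@dipath D) R && pairwise (fun p q : seq D => [disjoint p & q]) R.
Proof.
elim: R => [|p R IH] //; rewrite -cat1s path_system_cat path_system1 IH /= cats0.
have -> : ~~ has (mem p) (flatten R) = all (fun q : seq D => [disjoint p & q]) R.
  apply/hasPn/allP => [dis q qR|dis x /flattenP[q qR xq]].
    rewrite disjoint_sym disjoint_has; apply/hasPn=> x xq; apply: dis.
    by apply/flattenP; exists q.
  by have := dis q qR; rewrite disjoint_sym disjoint_has => /hasPn/(_ x xq).
by case: (dipath p) => //=; case: (all (@dipath D) R) => //=; rewrite andbC.
Qed.

Lemma leq_lambda_k k n : 0 < n -> n <= lambda_k k D <->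
  exists R : seq (seq D), [/\ path_system R, size R = k & n <= size (flatten R)].
Proof.
move=> n0; have kpathE (P : k.-tuple {bseq #|D| of D}) : kpath P = path_system (map val P).
  by rewrite path_system_pairwise all_map pairwise_map.
have sizeE (P : k.-tuple {bseq #|D| of D}) : \sum_(p <- P) size p = size (flatten (map val P)).
  by rewrite size_flatten sumnE /shape -map_comp big_map.
split=> [|[R [okR szR nR]]].
  case: (boolP [exists P : k.-tuple {bseq #|D| of D}, kpath P && (n <= \sum_(p <- P) size p)]).
    case/existsP=> P /andP[]; rewrite kpathE sizeE => okP nP _.
    by exists (map val P); rewrite size_map size_tuple.
  rewrite negb_exists => /forallP noP; rewrite leqNgt => /negP[].
  rewrite -[n]prednK // ltnS; apply/bigmax_leqP => P okP; rewrite -ltnS prednK // ltnNge.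
  by have := noP P; rewrite okP.
pose P := map (@insub_bseq #|D| D) R.
have valP : map val P = R.
  rewrite -map_comp map_id_in // => p pR; rewrite /= val_insubd ifT //.
  apply: dipath_size; move: okR; rewrite path_system_pairwise => /andP[/allP okR _].
  exact: okR.
have szP : size P == k by rewrite size_map szR.
apply: leq_trans nR _; rewrite -valP -(sizeE (Tuple szP)).
have okP : kpath (Tuple szP) by rewrite kpathE /= valP.
exact: (leq_bigmax_cond (F := fun P : k.-tuple {bseq #|D| of D} => \sum_(p <- P) size p)).
Qed.

Lemma leq_lambda n : 0 < n -> n <= lambda D <-> exists2 p : seq D, dipath p & n <= size p.
Proof.
move=> n0; split=> [|[p dp np]].
  case: (boolP [exists p : {bseq #|D| of D}, dipath p && (n <= size p)]).
    by case/existsP=> p /andP[dp np] _; exists p.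
  rewrite negb_exists => /forallP noP; rewrite leqNgt => /negP[].
  rewrite -[n]prednK // ltnS; apply/bigmax_leqP => p dp; rewrite -ltnS prednK // ltnNge.
  by have := noP p; rewrite dp.
by apply: leq_trans np (leq_bigmax_cond (Bseq (dipath_size dp)) dp).
Qed.
End PathParameters.

(** A bound on the path systems of [B] is a statement on each of them, and [B]
    is the complement of [A]. *)
Lemma BNY_splits (D : digraph) : BNY D <->
  forall q (p : seq D), 0 < q -> dipath p -> q < size p -> splits [set: D] q.
Proof.
have valI (S : {set D}) : injective (val : induced S -> D) by apply: val_inj.
have val_arc (S : {set D}) (x y : induced S) : darc (val x) (val y) = darc x y by [].
have cod (S : {set D}) x : (x \in codom (val : induced S -> D)) = (x \in S).
  apply/codomP/idP=> [[y ->]|xS]; first exact: (valP y).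
  by exists (exist _ x xS).
split=> [bnyD q p q0 dp qp|splitD q /andP[q0 qD]].
  have [|A [B [[dis cov] lamA lamB]]] := bnyD q.
    by rewrite q0 subn1 -ltnS prednK; [apply/leq_lambda => //; exists p
      | apply/leq_lambda => //; exists p; rewrite // (leq_trans _ qp)].
  exists A; split; first exact: subsetT.
    move=> p' dp' p'A; have [|p0 def_p'] := @lift_path _ _ (val : induced A -> D) p'.
      by move=> x /p'A; rewrite cod.
    apply: leq_trans lamA; rewrite def_p' size_map; have [->//|p00] := posnP (size p0).
    by apply/leq_lambda => //; exists p0; rewrite // -(dipath_map (valI _) (val_arc _)) -def_p'.
  move=> R R0 okR RA; have [|R0' def_R] := @lift_system _ _ (val : induced B -> D) R.
    move=> x /RA; rewrite cod !inE => xA.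
    by have : x \in A :|: B; [rewrite cov inE | rewrite inE (negPf xA)].
  have ok0 : path_system R0' by rewrite -(path_system_map (valI _) (val_arc _)) -def_R.
  have k_bounds : 1 <= size R <= #|induced B|.
    rewrite R0 def_R size_map -cardsT; apply: (size_path_system ok0) => x _.
    by rewrite inE.
  have := lamB _ k_bounds; set lB := lambda_k _ _ => lamR.
  have le_R : size (flatten R) <= lB.
    have [->//|R_gt0] := posnP (size (flatten R)).
    apply/leq_lambda_k => //; exists R0'; rewrite def_R -map_flatten !size_map.
    by split.
  have /leq_lambda_k[|R' [okR' szR' gR']] := leq_trans (leq_add le_R (leqnn q)) lamR.
    by rewrite addn_gt0 q0 orbT.
  by exists R'; split=> // x _; rewrite !inE orbT.
have /leq_lambda[//|p dp qp] : q < lambda D by lia.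
have [A [_ sA gA]] := splitD q p q0 dp qp.
exists A, (~: A); split.
- by split; [rewrite -setI_eq0 setICr | rewrite setUCr].
- apply/bigmax_leqP => p' dp'; rewrite -(size_map val); apply: sA.
    by rewrite (dipath_map (valI _) (val_arc _)).
  by move=> x xp; rewrite -cod; case/mapP: xp => y _ ->; apply: codom_f.
move=> k /andP[k0 kB].
(* As [k <= #|B|], there is a path system with [k] paths even when the maximum
   is 0. *)
have [R [okR szR leR]] : exists R : seq (seq (induced (~: A))),
    [/\ path_system R, size R = k & lambda_k k (induced (~: A)) <= size (flatten R)].
  have [->|lam0] := posnP (lambda_k k (induced (~: A))); last exact/leq_lambda_k.
  have [||||R [okR szR _ _]] := @raise_system (induced (~: A)) k [::] setT; rewrite ?cardsT //.
  by exists R.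
have [||| R' [okR' szR' _ gR']] := gA (map (map val) R).
- by rewrite size_map szR.
- by rewrite (path_system_map (valI _) (val_arc _)).
- by move=> x; rewrite -map_flatten => /mapP[y _ ->]; apply: (valP y).
apply: leq_trans (leq_add leR (leqnn q)) _; apply/leq_lambda_k; first by rewrite addn_gt0 q0 orbT.
exists R'; rewrite szR' size_map; split=> //.
by move: gR'; rewrite -map_flatten size_map.
Qed.

Section Class.
Variables (T : digraph) (H : T -> digraph).
Let c (x : composition H) : T := tag x.

(** The only fact on arcs of a composition between different classes that the
    argument uses. *)
Lemma composition_cross x y : c x != c y -> darc x y = darc (c x) (c y).
Proof. by rewrite /c /= /composition_arc => /negPf ->. Qed.

Lemma BNY_class_splits i q p : BNY (H i) -> 0 < q -> dipath p ->
  {subset p <= over c [set i]} -> q < size p -> class_splits c i q.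
Proof.
move=> /BNY_splits bnyH q0 dp pi qp.
pose f (x : H i) : composition H := Tagged H x.
have f_inj : injective f by move=> x y /eqP; rewrite /f eq_Tagged => /eqP.
have f_arc x y : darc (f x) (f y) = darc x y.
  by rewrite /= /composition_arc /= tagged_asE eqxx darc_irrefl orbF.
have cod x : (x \in codom f) = (x \in over c [set i]).
  rewrite !inE; apply/codomP/eqP=> [[y ->]//|].
  by case: x => j x; rewrite /c /= => ji; case: i / ji @f {f_inj f_arc bnyH dp pi} => f; exists x.
have [|p0 def_p] := @lift_path _ _ f p; first by move=> x /pi; rewrite cod.
have [||A0 [_ sA0 gA0]] := bnyH q p0 q0.
- by rewrite -(dipath_map f_inj f_arc) -def_p.
- by rewrite def_p size_map in qp.
have imA x0 : (f x0 \in f @: A0) = (x0 \in A0) by apply: mem_imset.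
exists (f @: A0); split.
- by apply/subsetP=> _ /imsetP[x _ ->]; rewrite -cod codom_f.
- move=> p' dp' p'A; have [|p1 def_p'] := @lift_path _ _ f p'.
    by move=> x /p'A/imsetP[y _ ->]; apply: codom_f.
  rewrite def_p' size_map; apply: sA0; first by rewrite -(dipath_map f_inj f_arc) -def_p'.
  by move=> x xp; rewrite -imA; apply: p'A; rewrite def_p' map_f.
move=> R R0 okR RA; have [|R1 def_R] := @lift_system _ _ f R.
  by move=> x /RA; rewrite inE cod => /andP[].
have [|||R' [okR' szR' _ gR']] := gA0 R1.
- by rewrite def_R size_map in R0.
- by rewrite -(path_system_map f_inj f_arc) -def_R.
- move=> x xR; rewrite inE -imA; have := RA (f x).
  by rewrite def_R -map_flatten map_f // => /(_ isT); rewrite inE => /andP[].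
exists (map (map f) R'); rewrite (path_system_map f_inj f_arc); split=> //.
- by rewrite size_map szR' def_R size_map.
- by move=> x; rewrite -map_flatten => /mapP[y _ ->]; rewrite -cod codom_f.
- by rewrite def_R -!map_flatten !size_map.
Qed.
End Class.

Theorem theorem4 (T : digraph) (H : T -> digraph)
    (T_semicomplete : semicomplete T)
    (H_nonempty : forall i : T, 0 < #|H i|)
    (H_BNY : forall i : T, BNY (H i)) :
  BNY (composition H).
Proof.
apply/BNY_splits => q p q0 dp qp; pose c (x : composition H) : T := tag x.
apply: (splitsS (subsetT (over c setT))).
apply: (splits_over T_semicomplete (@composition_cross _ H) _ dp _ qp).
  move=> i q' p' q'0 dp' p'i qp'; exact: BNY_class_splits (H_BNY i) q'0 dp' p'i qp'.
by move=> x _; rewrite !inE.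
Qed.
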